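(* Let $(X,\mathcal E)$ and $(Y,\mathcal F)$ be uniformly locally finite coarse spaces and let $\Phi\colon\mathrm{C}^*_u(X)\to\mathrm{C}^*_u(Y)$ be a $*$-isomorphism. If $X$ is metrizable and $\mathrm{C}^*_u(X)$ has no block-rank-one ghost projections, then $(X,\mathcal E)$ and $(Y,\mathcal F)$ are coarsely equivalent. In particular, $(Y,\mathcal F)$ is metrizable. Moreover, there exists a map $g\colon Y\to X$ for which some $\delta>0$ satisfies $\|\Phi^{-1}(\chi_{y})\delta_{g(y)}\|>\delta$ for all $y\in Y$, and any map $g\colon Y\to X$ with this property is a coarse equivalence.
   Context: A coarse space is a set $X$ with a family $\mathcal E$ of subsets of $X\times X$ (entourages) that contains the diagonal $\Delta_X$ and is closed under subsets, finite unions, inverses $E^{-1}=\{(y,x):(x,y)\in E\}$ and compositions $E\circ F=\{(x,y):\exists z,\ (x,z)\in E,\ (z,y)\in F\}$. It is uniformly locally finite if $\sup_{x\in X}|\{z\in X:(x,z)\in E\}|<\infty$ for all $E\in\mathcal E$. It is metrizable if $\mathcal E=\mathcal E_d:=\{E\subseteq X\times X:\sup_{(x,y)\in E}d(x,y)<\infty\}$ for some metric $d$ on $X$. A map $f\colon(X,\mathcal E)\to(Y,\mathcal F)$ is coarse if for all $E\in\mathcal E$ there is $F\in\mathcal F$ such that $(x,z)\in E$ implies $(f(x),f(z))\in F$; expanding if for all $F\in\mathcal F$ there is $E\in\mathcal E$ such that $(x,z)\notin E$ implies $(f(x),f(z))\notin F$; a coarse embedding if it is coarse and expanding; a coarse equivalence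 if it is a coarse embedding and there is $F\in\mathcal F$ such that for all $y\in Y$ there is $x\in X$ with $(f(x),y)\in F$. Two coarse spaces are coarsely equivalent if there is a coarse equivalence between them. $(\delta_x)_{x\in X}$ is the canonical basis of $\ell_2(X)$; for $A\subseteq X$, $\chi_A$ is the orthogonal projection onto $\ell_2(A)$, and $\chi_x=\chi_{\{x\}}$. For $a\in\mathcal B(\ell_2(X))$, $a_{x,z}=\langle a\delta_z,\delta_x\rangle$ and $\mathrm{supp}(a)=\{(x,z):a_{x,z}\neq0\}$. The uniform Roe algebra $\mathrm{C}^*_u(X)$ is the norm closure of $\{a\in\mathcal B(\ell_2(X)):\mathrm{supp}(a)\in\mathcal E\}$. $a\in\mathrm{C}^*_u(X)$ is a ghost if for all $\varepsilon>0$ there is a finite $A\subseteq X$ with $|a_{x,z}|\le\varepsilon$ for all $x,z\notin A$. A projection $p\in\mathrm{C}^*_u(X)$ is block-rank-one if there is a disjoint sequence $(X_n)_{n\in\mathbb N}$ of finite non-empty subsets of $X$ with $p=\sum_n\chi_{X_n}p\chi_{X_n}$ (convergence in the strong operator topology) and each $\chi_{X_n}p\chi_{X_n}$ of rank 1. *)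

(* Defs.v *)
From HB Require Import structures.
From mathcomp Require Import all_boot all_order all_algebra finmap.
From mathcomp Require Import all_classical all_reals all_analysis.
From mathcomp Require Import complex ring.
From mathcomp.analysis.showcase Require summability.
Import numFieldNormedType.Exports.

Set Implicit Arguments.
Unset Strict Implicit.
Unset Printing Implicit Defensive.

Import Order.TTheory GRing.Theory Num.Theory.
Import ComplexField.Normc.

Local Open Scope classical_set_scope.
Local Open Scope card_scope.
Local Open Scope ring_scope.

(* In [relation_scope], F \; E is the set of the (x, y) such that (x, z) is in E
   and (z, y) is in F for some z. *)
Record coarseStructure (X : Type) := CoarseStructure {
  entourages : set (set (X * X)) ;
  entourages_diag : entourages diagonal ;
  entourages_sub : forall E F, F `<=` E -> entourages E -> entourages F ;
  entourages_union : forall E F,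
    entourages E -> entourages F -> entourages (E `|` F) ;
  entourages_inv : forall E, entourages E -> entourages (E^-1)%relation ;
  entourages_comp : forall E F,
    entourages E -> entourages F -> entourages (F \; E)%relation }.

Definition uniformly_locally_finite X (EX : coarseStructure X) :=
  forall E, entourages EX E ->
    exists n : nat, forall x, [set z | E (x, z)] #<= `I_n.

Record is_metric (R : realType) X (d : X -> X -> R) : Prop := IsMetric {
  metric_ge0 : forall x y, 0 <= d x y ;
  metric_eq0 : forall x y, d x y = 0 <-> x = y ;
  metric_symm : forall x y, d x y = d y x ;
  metric_tri : forall x y z, d x z <= d x y + d y z }.

Definition metrizable (R : realType) X (EX : coarseStructure X) :=
  exists2 d : X -> X -> R, is_metric d &
    forall E, entourages EX E <-> has_ubound [set d xy.1 xy.2 | xy in E].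

Section maps.
Context {X Y : Type} (EX : coarseStructure X) (EY : coarseStructure Y).
Implicit Type f : X -> Y.

Definition coarse f :=
  forall E, entourages EX E -> exists2 F, entourages EY F &
    forall x z, E (x, z) -> F (f x, f z).

Definition expanding f :=
  forall F, entourages EY F -> exists2 E, entourages EX E &
    forall x z, ~ E (x, z) -> ~ F (f x, f z).

Definition coarse_embedding f := coarse f /\ expanding f.

Definition coarse_equivalence f := coarse_embedding f /\
  exists2 F, entourages EY F & forall y, exists x, F (f x, y).

Definition coarsely_equivalent := exists f, coarse_equivalence f.

End maps.

Section l2_def.
Context (R : realType) (X : choiceType).
Implicit Types f g : X -> R[i]^o.

Definition sqsum f : \bar R := \esum_(x in [set: X]) ((normc (f x)) ^+ 2)%:E.

Definition l2_pred : {pred X -> R[i]^o} := [pred f | `[< (sqsum f < +oo)%E >]].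

Record l2 := L2 { l2val :> X -> R[i]^o ; l2P : l2val \in l2_pred }.

HB.instance Definition _ := [isSub for l2val].
HB.instance Definition _ := [Choice of l2 by <:].

Lemma sqsum_ge0 f : (0 <= sqsum f)%E.
Proof. by apply: esum_ge0 => x _; rewrite lee_fin sqr_ge0. Qed.

Lemma l2_predP f : reflect (sqsum f < +oo)%E (f \in l2_pred).
Proof. by rewrite inE; exact: asboolP. Qed.

Lemma esumZ_le (k : R) (a : X -> R) : 0 <= k -> (forall x, 0 <= a x) ->
  (\esum_(x in [set: X]) (k * a x)%:E <=
   k%:E * \esum_(x in [set: X]) (a x)%:E)%E.
Proof.
move=> k0 a0; apply: ge_ereal_sup => _ [A [finA AT] <-].
under eq_fsbigr do rewrite EFinM.
rewrite -ge0_mule_fsumr; last by move=> x; rewrite lee_fin.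
rewrite lee_wpmul2l ?lee_fin//; apply: esum_ge.
by exists A.
Qed.

Lemma sqsum_le2 (h f g : X -> R[i]^o) (k l : R) : 0 <= k -> 0 <= l ->
  (forall x, normc (h x) ^+ 2 <= k * normc (f x) ^+ 2 + l * normc (g x) ^+ 2) ->
  (sqsum h <= k%:E * sqsum f + l%:E * sqsum g)%E.
Proof.
move=> k0 l0 hfg.
apply: (@le_trans _ _ (\esum_(x in [set: X])
  ((k * normc (f x) ^+ 2)%:E + (l * normc (g x) ^+ 2)%:E))%E).
  by apply: le_esum => x _; rewrite -EFinD lee_fin.
rewrite esumD; [|by move=> x _; rewrite lee_fin mulr_ge0 ?sqr_ge0..].
by apply: leeD; apply: esumZ_le => // x; rewrite sqr_ge0.
Qed.

Lemma normc_ge0 (x : R[i]) : 0 <= normc x.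
Proof. by case: x => a b; exact: sqrtr_ge0. Qed.

Lemma normc_sqrD2 (x y : R[i]) :
  normc (x + y) ^+ 2 <= 2 * normc x ^+ 2 + 2 * normc y ^+ 2.
Proof.
case: x y => [a b] [c d] /=.
rewrite !sqr_sqrtr ?addr_ge0 ?sqr_ge0// -subr_ge0.
rewrite (_ : _ - _ = (a - c) ^+ 2 + (b - d) ^+ 2); last first.
  by rewrite !expr2 !mulrDl !mulrDr !mulrN !mulNr; ring.
by rewrite addr_ge0 ?sqr_ge0.
Qed.

Lemma sqsum0 : sqsum 0 = 0%E.
Proof. by apply: esum1 => x _; rewrite normc0 expr0n. Qed.

Lemma l2_submod_closed : submod_closed l2_pred.
Proof.
split=> [|c f g /l2_predP fl /l2_predP gl]; apply/l2_predP.
  by rewrite sqsum0.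
apply: (@le_lt_trans _ _
  ((2 * normc c ^+ 2)%:E * sqsum f + 2%:E * sqsum g)%E).
  apply: sqsum_le2 => [||x].
  - by apply: mulr_ge0; [exact: ler0n|exact: sqr_ge0].
  - exact: ler0n.
  - by rewrite -mulrA -exprMn -normcM; exact: normc_sqrD2.
apply: lte_add_pinfty; apply: lte_mul_pinfty => //; rewrite lee_fin ?ler0n//.
by apply: mulr_ge0; [exact: ler0n|exact: sqr_ge0].
Qed.

HB.instance Definition _ :=
  GRing.isSubmodClosed.Build R[i] (X -> R[i]^o) l2_pred l2_submod_closed.
HB.instance Definition _ := [SubChoice_isSubLmodule of l2 by <:].

Definition l2norm (u : l2) : R := Num.sqrt (fine (sqsum u)).

Lemma l2norm_ge0 u : 0 <= l2norm u. Proof. exact: sqrtr_ge0. Qed.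

Lemma sqsumE (u : l2) : sqsum u = (l2norm u ^+ 2)%:E.
Proof.
have uoo : (sqsum u < +oo)%E by apply/l2_predP/l2P.
rewrite sqr_sqrtr ?fine_ge0 ?sqsum_ge0// fineK//.
by rewrite ge0_fin_numE ?sqsum_ge0.
Qed.

Lemma le_l2norm (u : l2) (M : R) :
  0 <= M -> (sqsum u <= (M ^+ 2)%:E)%E -> l2norm u <= M.
Proof. by move=> M0; rewrite sqsumE lee_fin ler_pXn2r// nnegrE ?l2norm_ge0. Qed.

Lemma normc_le_l2norm (u : l2) x : normc (u x) <= l2norm u.
Proof.
rewrite -(@ler_pXn2r _ 2)// ?nnegrE ?l2norm_ge0 ?normc_ge0//.
rewrite -lee_fin -sqsumE; apply: esum_ge; exists [set x].
  by split=> //; exact: finite_set1.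
by rewrite fsbig_set1.
Qed.

Lemma l2norm_eq0 (u : l2) : l2norm u = 0 -> u = 0.
Proof.
move=> u0; apply/val_inj/funext => x; apply: eq0_normc.
by apply/eqP; rewrite eq_le -{1}u0 normc_le_l2norm normc_ge0.
Qed.

Lemma l2normD (u v : l2) : l2norm (u + v) <= l2norm u + l2norm v.
Proof.
have [u0|u0] := eqVneq (l2norm u) 0.
  by rewrite u0 (l2norm_eq0 u0) !add0r.
have [v0|v0] := eqVneq (l2norm v) 0.
  by rewrite v0 (l2norm_eq0 v0) !addr0.
set a := l2norm u in u0 *; set b := l2norm v in v0 *.
have a0 : 0 < a by rewrite lt_neqAle eq_sym u0 l2norm_ge0.
have b0 : 0 < b by rewrite lt_neqAle eq_sym v0 l2norm_ge0.
apply: le_l2norm; first by rewrite addr_ge0// ltW.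
rewrite (_ : ((a + b) ^+ 2)%:E =
    (((a + b) / a)%:E * sqsum u + ((a + b) / b)%:E * sqsum v)%E); last first.
  rewrite !sqsumE -!EFinM -EFinD -/a -/b; congr EFin.
  by field; rewrite u0 v0.
have ab0 : 0 <= a + b by apply: addr_ge0; exact: ltW.
apply: sqsum_le2 => [||x].
- by rewrite divr_ge0// ltW.
- by rewrite divr_ge0// ltW.
set s := normc (u x); set t := normc (v x).
have s0 : 0 <= s by exact: normc_ge0.
have t0 : 0 <= t by exact: normc_ge0.
apply: (@le_trans _ _ ((s + t) ^+ 2)).
  apply: lerXn2r; rewrite ?nnegrE ?normc_ge0 ?addr_ge0//.
  exact: (le_normcD (u x) (v x)).
rewrite -subr_ge0 (_ : _ - _ = (s * b - t * a) ^+ 2 / (a * b)).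
  by rewrite divr_ge0 ?sqr_ge0// mulr_ge0// ltW.
by field; rewrite u0 v0.
Qed.

Lemma l2normZ_le (c : R[i]) (u : l2) : l2norm (c *: u) <= normc c * l2norm u.
Proof.
apply: le_l2norm; first by rewrite mulr_ge0 ?normc_ge0 ?l2norm_ge0.
rewrite exprMn EFinM -sqsumE.
apply: le_trans (esumZ_le _ _) => [||x]; rewrite ?sqr_ge0//.
by apply: le_esum => x _; rewrite lee_fin normcM exprMn.
Qed.

Lemma l2normZ (c : R[i]) (u : l2) : l2norm (c *: u) = normc c * l2norm u.
Proof.
have [->|c0] := eqVneq c 0.
  rewrite scale0r normc0 mul0r; apply/eqP; rewrite eq_le l2norm_ge0 andbT.
  by apply: le_l2norm => //; rewrite sqsum0 lee_fin sqr_ge0.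
have nc0 : normc c != 0 by apply: contra_neq c0; exact: eq0_normc.
have ncgt0 : 0 < normc c.
  by rewrite lt_neqAle eq_sym nc0 normc_ge0.
apply/eqP; rewrite eq_le l2normZ_le/=.
rewrite -ler_pdivlMl// -normcV -{1}[u]scale1r -(mulVf c0) -scalerA.
exact: l2normZ_le.
Qed.

(* A normed module over R[i] has its norm in R[i], where 0 <= z means that z is
   a nonnegative real: `|u| is the real number [l2norm u] seen in R[i]. *)
Let norm (u : l2) : R[i] := (l2norm u)%:C%C.

Let norm_triangle u v : norm (u + v) <= norm u + norm v.
Proof. by rewrite -rmorphD lecR l2normD. Qed.

Let norm_scale c u : norm (c *: u) = `|c| * norm u.
Proof. by rewrite /norm l2normZ rmorphM; case: c. Qed.

Let norm_eq0 u : norm u = 0 -> u = 0.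
Proof. by move=> [] /l2norm_eq0. Qed.

HB.instance Definition _ :=
  Lmodule_isNormed.Build R[i] l2 norm_triangle norm_scale norm_eq0.

Lemma l2_normE (u : l2) : `|u| = (l2norm u)%:C%C.
Proof. by []. Qed.

End l2_def.

Section bop_def.
Context (R : realType) (V : normedModType R[i]).
Implicit Types (a b : V -> V) (u v : V).

Definition bounded_op a :=
  linear a /\ exists M : R, forall v, `|a v| <= M%:C%C * `|v|.

Definition bop_pred : {pred V -> V} := [pred a | `[< bounded_op a >]].

Record bop := Bop { bop_fun :> V -> V ; bopP : bop_fun \in bop_pred }.

HB.instance Definition _ := [isSub for bop_fun].
HB.instance Definition _ := [Choice of bop by <:].

Lemma bop_predP a : reflect (bounded_op a) (a \in bop_pred).
Proof. by rewrite inE; exact: asboolP. Qed.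

Lemma bop_linear (a : bop) : linear a.
Proof. by have /bop_predP[] := bopP a. Qed.

Lemma bop_bounded (a : bop) : exists2 M : R, 0 <= M &
  forall v, `|a v| <= M%:C%C * `|v|.
Proof.
have /bop_predP[_ [M aM]] := bopP a; exists `|M| => // v.
by apply: le_trans (aM v) _; rewrite ler_wpM2r// lecR ler_norm.
Qed.

Lemma bop_submod_closed : submod_closed bop_pred.
Proof.
split=> [|c a b /bop_predP[la [M aM]] /bop_predP[lb [N bN]]]; apply/bop_predP.
  split=> [k u v|]; first by rewrite /= scaler0 addr0.
  by exists 0 => v; rewrite normr0 mul0r.
have abE v : (c *: a + b) v = c *: a v + b v by [].
split=> [k u v|].
  by rewrite !abE la lb !scalerDr !scalerA (mulrC c) addrACA.
exists (normc c * M + N) => v; rewrite abE.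
apply: le_trans (ler_normD _ _) _; rewrite normrZ rmorphD rmorphM mulrDl.
have ncE : `|c| = (normc c)%:C%C by case: (c).
by apply: lerD => //; rewrite /= -mulrA -ncE ler_wpM2l.
Qed.

HB.instance Definition _ :=
  GRing.isSubmodClosed.Build R[i] (V -> V) bop_pred bop_submod_closed.
HB.instance Definition _ := [SubChoice_isSubLmodule of bop by <:].

Fact id_bop : idfun \in bop_pred.
Proof. by apply/bop_predP; split=> //; exists 1 => v; rewrite mul1r. Qed.

Fact comp_bop (a b : bop) : a \o b \in bop_pred.
Proof.
apply/bop_predP; split=> [k u v|]; first by rewrite /= !bop_linear.
have [M M0 aM] := bop_bounded a; have [N _ bN] := bop_bounded b.
exists (M * N) => v; apply: le_trans (aM _) _.
by rewrite rmorphM -mulrA ler_wpM2l// (@lecR R 0).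
Qed.

Definition bop1 := Bop id_bop.
Definition bop_mul (a b : bop) := Bop (comp_bop a b).

Fact bop_mulA : associative bop_mul.
Proof. by move=> a b c; exact: val_inj. Qed.
Fact bop_mul1l : left_id bop1 bop_mul. Proof. by move=> a; exact: val_inj. Qed.
Fact bop_mul1r : right_id bop1 bop_mul. Proof. by move=> a; exact: val_inj. Qed.
Fact bop_mulDl : left_distributive bop_mul +%R.
Proof. by move=> a b c; exact: val_inj. Qed.
Fact bop_mulDr : right_distributive bop_mul +%R.
Proof.
move=> a b c; apply/val_inj/funext => v.
by have /= := bop_linear a 1 (b v) (c v); rewrite !scale1r.
Qed.

HB.instance Definition _ := GRing.Zmodule_isPzRing.Build bop
  bop_mulA bop_mul1l bop_mul1r bop_mulDl bop_mulDr.

Definition opnorm (a : bop) : R :=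
  sup [set complex.Re `|a v| | v in [set v : V | `|v| <= 1]].

Let nrm v : R := complex.Re `|v|.

Let nrmE v : `|v| = (nrm v)%:C%C.
Proof. by rewrite RRe_real// normr_real. Qed.

Let opnorm_has_sup (a : bop) :
  has_sup [set nrm (a v) | v in [set v : V | `|v| <= 1]].
Proof.
split; first by exists (nrm (a 0)), 0 => //=; rewrite normr0 ler01.
have [M M0 aM] := bop_bounded a; exists M => _ [v /= v1 <-].
rewrite -lecR -nrmE; apply: le_trans (aM v) _.
by rewrite ler_piMr// (@lecR R 0).
Qed.

Lemma bop0 (a : bop) : a 0 = 0.
Proof.
by have := bop_linear a (-1) 0 0; rewrite scaler0 addr0 scaleN1r addNr.
Qed.

Lemma bopZ (a : bop) k v : a (k *: v) = k *: a v.
Proof. by rewrite -[k *: v]addr0 bop_linear bop0 addr0. Qed.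

Lemma le_opnorm (a : bop) v : `|a v| <= (opnorm a)%:C%C * `|v|.
Proof.
have [->|v0] := eqVneq v 0; first by rewrite bop0 !normr0 mulr0.
have nv0 : 0 < `|v| by rewrite normr_gt0.
have -> : `|a v| = `|a (`|v|^-1 *: v)| * `|v|.
  by rewrite bopZ normrZ normfV normr_id mulrAC mulVf ?mul1r// gt_eqF.
rewrite ler_wpM2r// nrmE lecR.
apply: ub_le_sup; first exact: (opnorm_has_sup a).2.
by exists (`|v|^-1 *: v) => //=; rewrite normrZ normfV normr_id mulVf ?gt_eqF.
Qed.

Lemma opnorm_le (a : bop) (M : R) : 0 <= M ->
  (forall v, `|a v| <= M%:C%C * `|v|) -> opnorm a <= M.
Proof.
move=> M0 aM; apply: ge_sup; first exact: (opnorm_has_sup a).1.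
move=> _ [v /= v1 <-]; rewrite -lecR -/(nrm _) -nrmE; apply: le_trans (aM v) _.
by rewrite ler_piMr// (@lecR R 0).
Qed.

Lemma opnorm_ge0 (a : bop) : 0 <= opnorm a.
Proof.
apply: ub_le_sup; first exact: (opnorm_has_sup a).2.
by exists 0; rewrite /= ?bop0 normr0 ?ler01.
Qed.

Let norm (a : bop) : R[i] := (opnorm a)%:C%C.

Let norm_triangle (a b : bop) : norm (a + b) <= norm a + norm b.
Proof.
rewrite -rmorphD lecR; apply: opnorm_le => [|v].
  by rewrite addr_ge0 ?opnorm_ge0.
rewrite rmorphD mulrDl; apply: le_trans (ler_normD _ _) _.
by apply: lerD; exact: le_opnorm.
Qed.

Let opnormZ_le (c : R[i]) (a : bop) : opnorm (c *: a) <= normc c * opnorm a.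
Proof.
apply: opnorm_le => [|v]; first by rewrite mulr_ge0 ?normc_ge0 ?opnorm_ge0.
have ncE : `|c| = (normc c)%:C%C by case: (c).
rewrite normrZ rmorphM /= -ncE -mulrA.
by rewrite ler_wpM2l ?le_opnorm.
Qed.

Let norm_scale c (a : bop) : norm (c *: a) = `|c| * norm a.
Proof.
suff -> : norm (c *: a) = (normc c * opnorm a)%:C%C.
  by rewrite rmorphM; case: c.
congr real_complex_def; have [->|c0] := eqVneq c 0.
  apply/eqP; rewrite eq_le opnormZ_le.
  by rewrite normc0 mul0r opnorm_ge0.
have nc0 : normc c != 0 by apply: contra_neq c0; exact: eq0_normc.
have ncgt0 : 0 < normc c by rewrite lt_neqAle eq_sym nc0 normc_ge0.
apply/eqP; rewrite eq_le opnormZ_le/=.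
rewrite -ler_pdivlMl// -normcV -{1}[a]scale1r -(mulVf c0) -scalerA.
exact: opnormZ_le.
Qed.

Let norm_eq0 (a : bop) : norm a = 0 -> a = 0.
Proof.
move=> [] a0; apply/val_inj/funext => v; apply/normr0_eq0/eqP.
rewrite eq_le normr_ge0 andbT; apply: le_trans (le_opnorm a v) _.
by rewrite a0 mul0r.
Qed.

HB.instance Definition _ :=
  Lmodule_isNormed.Build R[i] bop norm_triangle norm_scale norm_eq0.

Lemma bop_normE (a : bop) : `|a| = (opnorm a)%:C%C.
Proof. by []. Qed.

End bop_def.

Section l2_operators.
Context (R : realType) (X : choiceType).
Implicit Types (u v : l2 R X) (a b p : bop (l2 R X)) (A : set X) (x z : X).

(* The sum is the limit of the net of all finite partial sums; [inner] is
   linear in its first argument. *)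
Definition inner u v : R[i] :=
  @summability.sum X R[i] R[i]^o (fun x => u x * (v x)^*%C).

Fact delta_l2 x : (fun z => (z == x)%:R : R[i]^o) \in @l2_pred R X.
Proof.
apply/l2_predP; rewrite /sqsum.
rewrite (_ : esum _ _ = \esum_(z in [set x]) 1%:E).
  by rewrite esum_set1 ?lee_fin ?ltry.
rewrite [RHS]esum_mkcond; apply: eq_esum => z _.
have [->|zx] := eqVneq z x; first by rewrite mem_set// normc1 expr1n.
by rewrite memNset ?normc0 ?expr0n// => /= /eqP; exact/negP.
Qed.

Definition delta x : l2 R X := L2 (delta_l2 x).

Fact restrict_l2 A u : (fun x => if x \in A then u x else 0) \in @l2_pred R X.
Proof.
apply/l2_predP; apply: le_lt_trans (elimT (l2_predP _) (l2P u)).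
apply: le_esum => x _; case: ifP => // _.
by rewrite normc0 expr0n lee_fin sqr_ge0.
Qed.

Definition restrict_fun A u : l2 R X := L2 (restrict_l2 A u).

Fact chi_bop A : restrict_fun A \in @bop_pred R (l2 R X).
Proof.
apply/bop_predP; split=> [k u v|].
  apply/val_inj/funext => x; rewrite /= !fctE /=.
  by case: ifP => // _; rewrite scaler0 addr0.
exists 1 => u; rewrite mul1r !l2_normE lecR.
apply: le_l2norm; rewrite ?l2norm_ge0// -sqsumE.
apply: le_esum => x _ /=; case: ifP => // _.
by rewrite normc0 expr0n lee_fin sqr_ge0.
Qed.

Definition chi A : bop (l2 R X) := Bop (chi_bop A).

Lemma inner_delta u x : inner u (delta x) = u x.
Proof.
have FF : ProperFilter (@summability.totally X).
  exact: summability.totally_filter.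
rewrite /inner /summability.sum.
apply: (@cvg_lim R[i]^o); first exact: norm_hausdorff.
apply: cvg_near_cst.
exists [fset x]%fset => // B /=; rewrite fsub1set => xB.
rewrite /summability.partial_sum
  -(big_seq_fsetE _ _ xpredT (fun z => u z * ((z == x)%:R)^*%C)).
rewrite (bigD1_seq x)//= eqxx rmorph1 mulr1 big1 ?addr0// => z /negPf ->.
by rewrite rmorph0 mulr0.
Qed.

Definition coef a x z : R[i] := inner (a (delta z)) (delta x).

Lemma coefE a x z : coef a x z = a (delta z) x.
Proof. exact: inner_delta. Qed.

Definition supp a : set (X * X) := [set xz | coef a xz.1 xz.2 != 0].

(* [b] is the adjoint of [a]; it is unique, and exists for every bounded [a]. *)
Definition adjoint_of a b := forall u v, inner (a u) v = inner u (b v).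

Definition is_projection p := p * p = p /\ adjoint_of p p.

Definition rank_one a := exists2 w : l2 R X, w != 0 &
  range a = [set k *: w | k in [set: R[i]]].

Definition ghost a := forall e : R, 0 < e -> exists2 A : set X, finite_set A &
  forall x z, ~ A x -> ~ A z -> `|coef a x z| <= e%:C%C.

Definition block_rank_one p := exists F : nat -> set X,
  [/\ trivIset setT F,
      forall n, finite_set (F n) /\ F n !=set0,
      forall v : l2 R X,
        (fun N => \sum_(n < N) (chi (F n) * p * chi (F n)) v) @ \oo --> p v &
      forall n, rank_one (chi (F n) * p * chi (F n))].

End l2_operators.

Definition uRoe (R : realType) (X : choiceType) (EX : coarseStructure X) :
    set (bop (l2 R X)) :=
  closure [set a | entourages EX (supp a)].

Lemma chi_uRoe (R : realType) (X : choiceType) (EX : coarseStructure X)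
    (A : set X) : uRoe EX (chi R A).
Proof.
apply: subset_closure; apply: (entourages_sub _ (entourages_diag EX)).
move=> [x z]; rewrite /supp/= coefE /=; case: ifP => _; last by rewrite eqxx.
by case: (eqVneq x z) => // _; rewrite eqxx.
Qed.

Section isomorphisms.
Context (R : realType) (X Y : choiceType).
Context (EX : coarseStructure X) (EY : coarseStructure Y).
Implicit Type Phi : bop (l2 R X) -> bop (l2 R Y).

Definition star_isomorphism Phi :=
  [/\ set_bij (uRoe EX) (uRoe EY) Phi,
      {in uRoe EX &, {morph Phi : a b / a + b}},
      forall k : R[i], {in uRoe EX, {morph Phi : a / k *: a}},
      {in uRoe EX &, {morph Phi : a b / a * b}} &
      {in uRoe EX &, forall a b, adjoint_of a b -> adjoint_of (Phi a) (Phi b)}].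

(* The inverse of [Phi] is a junk value outside [uRoe EY]. *)
Definition iso_inv Phi : bop (l2 R Y) -> bop (l2 R X) :=
  'pinv_(fun=> 0) (uRoe EX) Phi.

End isomorphisms.

(* Main.v *)
(* The isomorphism is implemented spatially: the images of the rank-one diagonal
   projections are rank-one projections onto orthonormal vectors xi_y of l2(X)
   and eta_x of l2(Y), with eta_x(y) the conjugate of xi_y(x), and the entries of
   Phi(a) are the inner products <a xi_y', xi_y>.

   Transport of entourages: if F is an entourage of Y, the pairs (x, x') for which
   some (y, y') in F has |xi_y(x)|, |xi_y'(x')| >= d form an entourage of X.
   Index these configurations by s.  An operator b summing the matrix units of
   (y_s, y'_s) over a set of configurations has an image whose (x_t, x'_t) entry is
   one term of modulus >= d^2 plus the cross terms of the s <> t.  The matrix of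
   cross terms has nonnegative entries and bounded row and column sums, so it can be
   paved: finitely many classes cover all configurations and the cross terms
   inside a class are at most d^2/2.  In each class b lies in C*_u(Y), so its image
   lies in C*_u(X) and has large entries only along an entourage.  By symmetry this
   holds from X to Y too; no countability is needed.

   Consequently g : Y -> X with |xi_y(g y)| > d is a coarse equivalence as soon as
   some f : X -> Y has |xi_(f x)(x)| > d.
   - f exists because X is metrizable: otherwise eta_x becomes arbitrarily flat
     along a sequence x_n with almost disjoint supports, and balanced signs on
     these supports define a symmetry whose image sends delta_(x_n) essentially
     outside the ball of radius n around x_n, so it is not in C*_u(X).
   - g exists because there are no block-rank-one ghosts: otherwise some xi_(y_n)
     become flat, and cutting them down to disjoint finite sets perturbs the
     image of the projection onto l2({y_n}) into a block-rank-one ghost projection. *)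

From mathcomp Require Import all_boot all_order all_algebra finmap.
From mathcomp Require Import all_classical all_reals all_analysis.
From mathcomp Require Import complex ring lra.
From mathcomp.analysis.showcase Require summability.
Require Import Defs.
Import numFieldNormedType.Exports.

Set Implicit Arguments.
Unset Strict Implicit.
Unset Printing Implicit Defensive.

Import Order.TTheory GRing.Theory Num.Theory.
Import ComplexField.Normc.

Local Open Scope classical_set_scope.
Local Open Scope ring_scope.

(** * Inner products on l2 *)

Section complex_modulus.
Context (R : realType).
Implicit Types z w : R[i].

Lemma normcE z : `|z| = (normc z)%:C%C.
Proof. by case: z. Qed.

Lemma normc_eq0 z : normc z = 0 -> z = 0.
Proof. exact: eq0_normc. Qed.

Lemma normcD_le z w : normc (z + w) <= normc z + normc w.
Proof. exact: le_normcD. Qed.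

Lemma normcJ z : normc (z^*)%C = normc z.
Proof. by case: z => a b; rewrite /= sqrrN. Qed.

Lemma normc_distC z w : normc (z - w) = normc (w - z).
Proof. by rewrite -opprB normcN. Qed.

Lemma conjcM z w : conjc (z * w) = conjc z * conjc w.
Proof. exact: rmorphM. Qed.

Lemma conjcD z w : conjc (z + w) = conjc z + conjc w.
Proof. exact: rmorphD. Qed.

Lemma conjcN z : conjc (- z) = - conjc z.
Proof. exact: rmorphN. Qed.

Lemma normc_real (r : R) : 0 <= r -> normc r%:C%C = r.
Proof. by move=> r0; rewrite /= expr0n addr0 sqrtr_sqr ger0_norm. Qed.

Lemma mul_conjc z : z * (z^*)%C = (normc z ^+ 2)%:C%C.
Proof.
case: z => a b /=; rewrite sqr_sqrtr ?addr_ge0 ?sqr_ge0//.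
by apply/eqP; rewrite eq_complex /=; apply/andP; split; apply/eqP; ring.
Qed.

Lemma normc_sum (I : Type) (r : seq I) (P : pred I) (F : I -> R[i]) :
  normc (\sum_(i <- r | P i) F i) <= \sum_(i <- r | P i) normc (F i).
Proof.
elim/big_rec2: _ => [|i y1 y2 _ h]; first by rewrite normc0.
by apply: le_trans (normcD_le _ _) _; rewrite lerD2l.
Qed.

End complex_modulus.

(** * Finite partial sums and density of finitely supported vectors *)

Section finite_sums.
Context (R : realType) (X : choiceType).
Implicit Types (u v : l2 R X) (A B : {fset X}) (x z : X).

Lemma l2D u v x : (u + v) x = u x + v x. Proof. by []. Qed.
Lemma l2N u x : (- u) x = - u x. Proof. by []. Qed.
Lemma l2B u v x : (u - v) x = u x - v x. Proof. by []. Qed.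
Lemma l2Z (k : R[i]) u x : (k *: u) x = k * u x. Proof. by []. Qed.
Lemma l20 x : (0 : l2 R X) x = 0. Proof. by []. Qed.
Lemma l2_sum (I : Type) (r : seq I) (P : pred I) (F : I -> l2 R X) x :
  (\sum_(i <- r | P i) F i) x = \sum_(i <- r | P i) F i x.
Proof. by elim/big_rec2: _ => [//|i a b _ <-]. Qed.
Lemma deltaE x z : delta R x z = (z == x)%:R. Proof. by []. Qed.
Lemma restrict_funE (S : set X) u x :
  restrict_fun S u x = if x \in S then u x else 0.
Proof. by []. Qed.

Lemma l2_ext u v : (forall x, u x = v x) -> u = v.
Proof. by move=> uv; apply/val_inj/funext. Qed.

Lemma sum_le_sqsum (f : X -> R[i]^o) (A : {fset X}) :
  ((\sum_(x <- A) normc (f x) ^+ 2)%:E <= sqsum f)%E.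
Proof.
apply: esum_ge; exists [set` A] => //.
rewrite fsbig_finite//= set_fsetK sumEFin//.
Qed.

Lemma sqsum_le (f : X -> R[i]^o) (M : R) :
  (forall A : {fset X}, \sum_(x <- A) normc (f x) ^+ 2 <= M) ->
  (sqsum f <= M%:E)%E.
Proof.
move=> h; apply: ge_ereal_sup => _ [S [finS _] <-].
by rewrite fsbig_finite//= sumEFin lee_fin.
Qed.

Lemma l2_mem (f : X -> R[i]^o) (M : R) :
  (forall A : {fset X}, \sum_(x <- A) normc (f x) ^+ 2 <= M) ->
  f \in @l2_pred R X.
Proof.
by move=> h; apply/l2_predP; apply: le_lt_trans (sqsum_le h) _; rewrite ltry.
Qed.

Lemma sum_le_l2norm u A : \sum_(x <- A) normc (u x) ^+ 2 <= l2norm u ^+ 2.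
Proof. by rewrite -lee_fin -sqsumE sum_le_sqsum. Qed.

Lemma l2norm_le u (M : R) : 0 <= M ->
  (forall A : {fset X}, \sum_(x <- A) normc (u x) ^+ 2 <= M ^+ 2) ->
  l2norm u <= M.
Proof. by move=> M0 h; apply: le_l2norm => //; exact: sqsum_le. Qed.

Lemma sum_approx_l2norm u (e : R) : 0 < e ->
  exists A, l2norm u ^+ 2 - e < \sum_(x <- A) normc (u x) ^+ 2.
Proof.
move=> e0; have : ((l2norm u ^+ 2 - e)%:E < sqsum u)%E.
  by rewrite sqsumE lte_fin ltrBlDr ltrDl.
move=> /ereal_sup_gt[_ [S [finS _] <-]].
rewrite fsbig_finite//= sumEFin lte_fin => h; by exists (fset_set S).
Qed.

Lemma ler_sum_fset (F : X -> R) A B : (forall x, 0 <= F x) ->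
  (A `<=` B)%fset -> \sum_(x <- A) F x <= \sum_(x <- B) F x.
Proof.
move=> F0 AB.
have -> : \sum_(x <- A) F x = \sum_(x <- [seq x <- B | x \in A]) F x.
  apply: perm_big; apply: uniq_perm; rewrite ?filter_uniq ?fset_uniq// => x.
  rewrite mem_filter; case: (boolP (x \in A)) => //= xA.
  by rewrite (fsubsetP AB).
rewrite big_filter big_mkcond /=; apply: ler_sum => x _; case: ifP => //.
Qed.

Lemma l2normN u : l2norm (- u) = l2norm u.
Proof. by rewrite -scaleN1r l2normZ normcN normc1 mul1r. Qed.

Lemma l2normB_sym u v : l2norm (u - v) = l2norm (v - u).
Proof. by rewrite -opprB l2normN. Qed.

Lemma l2norm0 : l2norm (0 : l2 R X) = 0.
Proof. by rewrite -(scale0r 0) l2normZ normc0 mul0r. Qed.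

Lemma l2norm_sum (I : Type) (r : seq I) (P : pred I) (F : I -> l2 R X) :
  l2norm (\sum_(i <- r | P i) F i) <= \sum_(i <- r | P i) l2norm (F i).
Proof.
elim/big_rec2: _ => [|i y1 y2 _ h]; first by rewrite l2norm0.
by apply: le_trans (l2normD _ _) _; rewrite lerD2l.
Qed.

Lemma l2norm_restrict_le (S : set X) u : l2norm (restrict_fun S u) <= l2norm u.
Proof.
apply: l2norm_le; first exact: l2norm_ge0.
move=> A; apply: le_trans (sum_le_l2norm u A); apply: ler_sum => x _ /=.
by case: ifP => // _; rewrite normc0 expr0n sqr_ge0.
Qed.

Lemma restrict_setC (S : set X) u : u - restrict_fun S u = restrict_fun (~` S) u.
Proof.
apply: l2_ext => x; rewrite l2B !restrict_funE in_setC.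
by case: (x \in S); rewrite /= ?subrr ?subr0.
Qed.

(** On a finite [B] the tail has the mass of [u] on the difference of [B] and [A]; adding the mass
    on [A] gives the mass on their union, which is at most [l2norm u ^+ 2]. *)
Lemma restrict_fsetC_sqr u A :
  l2norm (restrict_fun (~` [set` A]) u) ^+ 2 <=
  l2norm u ^+ 2 - \sum_(x <- A) normc (u x) ^+ 2.
Proof.
set w := restrict_fun _ _; set M := (X in _ <= X).
have M0 : 0 <= M by rewrite subr_ge0 sum_le_l2norm.
rewrite -(sqr_sqrtr M0) lerXn2r ?nnegrE ?l2norm_ge0 ?sqrtr_ge0//.
apply: l2norm_le => [|B]; first exact: sqrtr_ge0.
rewrite sqr_sqrtr// lerBrDr -(lerD2r 0) addr0.
have -> : \sum_(x <- B) normc (w x) ^+ 2 = \sum_(x <- (B `\` A)%fset) normc (u x) ^+ 2.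
  have wE x : w x = if x \in A then 0 else u x.
    by rewrite /w restrict_funE in_setC mem_setE; case: (x \in A).
  clearbody w.
  rewrite (bigID (mem A)) /= big1 ?add0r; last first.
    by move=> x xA; rewrite wE (xA : x \in A = true) normc0 expr0n.
  rewrite (eq_bigr (fun x => normc (u x) ^+ 2)); last first.
    by move=> x xA; rewrite wE (negbTE (xA : x \notin A)).
  rewrite -[LHS]big_filter.
  apply: perm_big; apply: uniq_perm; rewrite ?filter_uniq ?fset_uniq// => x.
  by rewrite mem_filter in_fsetD.
rewrite addr0; apply: le_trans (sum_le_l2norm u (A `|` B)%fset).
rewrite [X in _ <= X](bigID (mem A)) /= addrC lerD//.
  rewrite -[X in _ <= X]big_filter le_eqVlt; apply/orP; left; apply/eqP.
  apply: perm_big; apply: uniq_perm; rewrite ?filter_uniq ?fset_uniq// => x.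
  by rewrite mem_filter in_fsetU in_fsetD; case: (x \in A).
rewrite -[X in _ <= X]big_filter le_eqVlt; apply/orP; left; apply/eqP.
apply: perm_big; apply: uniq_perm; rewrite ?filter_uniq ?fset_uniq// => x.
by rewrite mem_filter in_fsetU; case: (x \in A).
Qed.

Lemma l2_dense_up u (e : R) : 0 < e ->
  exists A, forall B, (A `<=` B)%fset -> l2norm (u - restrict_fun [set` B] u) < e.
Proof.
move=> e0; have [|A hA] := @sum_approx_l2norm u (e ^+ 2); first by rewrite exprn_gt0.
exists A => B AB.
rewrite restrict_setC -(@ltr_pXn2r _ 2)// ?nnegrE ?l2norm_ge0 ?(ltW e0)//.
apply: le_lt_trans (restrict_fsetC_sqr _ _) _; rewrite ltrBlDr -ltrBlDl.
apply: lt_le_trans hA _; apply: ler_sum_fset => // x; exact: sqr_ge0.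
Qed.

Lemma l2_dense u (e : R) : 0 < e ->
  exists A, l2norm (u - restrict_fun [set` A] u) < e.
Proof. by move=> /(l2_dense_up u)[A hA]; exists A; exact: hA. Qed.

Lemma restrict_fset_sum u A :
  restrict_fun [set` A] u = \sum_(x <- A) u x *: delta R x.
Proof.
apply: l2_ext => z; rewrite l2_sum restrict_funE mem_setE.
under eq_bigr do rewrite l2Z deltaE.
case: ifPn => [zA|zA].
  rewrite (bigD1_seq z)//= eqxx mulr1 big1 ?addr0// => x /negPf.
  by rewrite eq_sym => ->; rewrite mulr0.
rewrite big_seq big1// => x xA; case: eqP => [zx|]; rewrite ?mulr0//.
by rewrite zx xA in zA.
Qed.

Lemma l2norm_delta x : l2norm (delta R x) = 1.
Proof.
apply/eqP; rewrite eq_le; apply/andP; split; last first.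
  apply: le_trans (normc_le_l2norm _ x); by rewrite deltaE eqxx normc1.
apply: l2norm_le => // A; rewrite expr1n.
case: (boolP (x \in A)) => xA.
  rewrite (bigD1_seq x)//= eqxx normc1 expr1n big1 ?addr0// => z /negPf ->.
  by rewrite normc0 expr0n.
rewrite big_seq big1// => z zA; rewrite deltaE.
case: (z =P x) => [zx|]; last by rewrite normc0 expr0n.
by rewrite -zx zA in xA.
Qed.

End finite_sums.

(** * Unconditional summation and the sesquilinear form *)

Section unconditional_sums.
Context (R : realType) (X : choiceType).
Implicit Types (f g : X -> R[i]) (l : R[i]) (u v w : l2 R X) (x : X).
Implicit Types (A B : {fset X}) (e : R).

(** Convergence of the net of finite partial sums, stated with real tolerances instead of the
    positive elements of [R[i]]. *)
Definition has_sum f l := forall e, 0 < e ->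
  exists A, forall B, (A `<=` B)%fset -> normc (\sum_(x <- B) f x - l) <= e.

Lemma has_sum_sum f l : has_sum f l ->
  @summability.sum X R[i] R[i]^o f = l.
Proof.
move=> fl; have FF : ProperFilter (@summability.totally X).
  exact: summability.totally_filter.
apply: (@cvg_lim R[i]^o); first exact: norm_hausdorff.
apply/(@cvgrPdist_le R[i] R[i]^o) => -[er ei] e0.
have [/= /eqP ei0 er0] : ei = 0 /\ 0 < er.
  by move: e0; rewrite ltcE /= => /andP[/eqP -> ->].
have [A hA] := fl er er0.
exists A => //= B AB; rewrite distrC /summability.partial_sum.
rewrite -(big_seq_fsetE _ _ xpredT f) normcE.
have -> : (er +i* ei)%C = er%:C%C by rewrite (eqP ei0).
by rewrite lecR; exact: hA.
Qed.

Lemma has_sum_ext f g l : (forall x, f x = g x) -> has_sum f l -> has_sum g l.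
Proof. by move=> /funext ->. Qed.

Lemma has_sumD f g l m :
  has_sum f l -> has_sum g m -> has_sum (fun x => f x + g x) (l + m).
Proof.
move=> fl gm e e0; have e20 : 0 < e / 2 by rewrite divr_gt0.
have [A hA] := fl _ e20; have [B hB] := gm _ e20.
exists (A `|` B)%fset => C; rewrite fsubUset => /andP[AC BC].
rewrite big_split /= opprD addrACA (splitr e).
by apply: le_trans (normcD_le _ _) _; apply: lerD; [exact: hA|exact: hB].
Qed.

Lemma has_sumZ (k : R[i]) f l : has_sum f l -> has_sum (fun x => k * f x) (k * l).
Proof.
move=> fl e e0; have k0 : 0 < normc k + 1 by rewrite ltr_wpDl ?normc_ge0.
have [|A hA] := fl (e / (normc k + 1)); first by rewrite divr_gt0.
exists A => B /hA h; rewrite -mulr_sumr -mulrBr normcM.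
apply: le_trans (_ : (normc k + 1) * (e / (normc k + 1)) <= _); last first.
  by rewrite mulrCA mulfV ?mulr1// gt_eqF.
by apply: ler_pM => //; rewrite ?normc_ge0// lerDl.
Qed.

Lemma has_sum_conj f l :
  has_sum f l -> has_sum (fun x => (f x)^*%C) (l^*)%C.
Proof.
move=> fl e /fl[A hA]; exists A => B /hA.
by rewrite -(normcJ (_ - l)) rmorphB rmorph_sum.
Qed.

Lemma has_sum_uniq f l m : has_sum f l -> has_sum f m -> l = m.
Proof. by move=> /has_sum_sum <- /has_sum_sum <-. Qed.

Lemma has_sum_sqr u :
  has_sum (fun x => (normc (u x) ^+ 2)%:C%C) (l2norm u ^+ 2)%:C%C.
Proof.
move=> e e0; have [A hA] := @sum_approx_l2norm R X u e e0.
exists A => B AB; rewrite -rmorph_sum -rmorphB -normcN -rmorphN opprB.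
rewrite normc_real ?subr_ge0 ?sum_le_l2norm// lerBlDr -lerBlDl.
apply: le_trans (ltW hA) _; apply: ler_sum_fset => // x; exact: sqr_ge0.
Qed.

(** Summability comes from polarization: the squared moduli of [u + v], [u - v], [u + iv] and
    [u - iv] are summable, and the products are a combination of these four families. *)
Lemma inner_has_sum u v : has_sum (fun x => u x * (v x)^*%C) (inner u v).
Proof.
pose I := ('i%C : R[i]).
pose q (w : l2 R X) := (l2norm w ^+ 2)%:C%C : R[i].
pose l := 4^-1 * ((q (u + v) + (-1) * q (u - v)) +
   (I * q (u + I *: v) + (- I) * q (u - I *: v))).
suff h : has_sum (fun x => u x * (v x)^*%C) l.
  by rewrite (_ : inner u v = l)//; exact: has_sum_sum h.
have := has_sumZ 4^-1 (has_sumD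
  (has_sumD (has_sum_sqr (u + v)) (has_sumZ (-1) (has_sum_sqr (u - v))))
  (has_sumD (has_sumZ I (has_sum_sqr (u + I *: v)))
            (has_sumZ (- I) (has_sum_sqr (u - I *: v))))).
apply: has_sum_ext => x.
rewrite !(l2D,l2N,l2Z,l2B) -!mul_conjc.
apply: (@mulfI _ 4%:R); first by rewrite pnatr_eq0.
rewrite mulVKf ?pnatr_eq0//.
rewrite /I; case: (u x) (v x) => [a b] [c d]; simpc.
by apply/eqP; rewrite eq_complex /=; apply/andP; split; apply/eqP; ring.
Qed.

Lemma innerP u v l :
  has_sum (fun x => u x * (v x)^*%C) l -> inner u v = l.
Proof. exact/has_sum_uniq/inner_has_sum. Qed.

Lemma innerDl u v w : inner (u + v) w = inner u w + inner v w.
Proof.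
apply: innerP; apply: has_sum_ext (has_sumD (inner_has_sum u w) (inner_has_sum v w)).
by move=> x; rewrite -mulrDl.
Qed.

Lemma innerZl k u v : inner (k *: u) v = k * inner u v.
Proof.
apply: innerP; apply: has_sum_ext (has_sumZ k (inner_has_sum u v)).
by move=> x; rewrite mulrA.
Qed.

Lemma innerC u v : inner u v = (inner v u)^*%C.
Proof.
apply: innerP; apply: has_sum_ext (has_sum_conj (inner_has_sum v u)).
by move=> x; rewrite conjcM conjcK mulrC.
Qed.

Lemma innerDr u v w : inner u (v + w) = inner u v + inner u w.
Proof. by rewrite innerC innerDl conjcD -!innerC. Qed.

Lemma innerZr k u v : inner u (k *: v) = k^*%C * inner u v.
Proof. by rewrite innerC innerZl conjcM -innerC. Qed.

Lemma innerNl u v : inner (- u) v = - inner u v.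
Proof. by rewrite -scaleN1r innerZl mulN1r. Qed.

Lemma innerNr u v : inner u (- v) = - inner u v.
Proof. by rewrite innerC innerNl conjcN -innerC. Qed.

Lemma innerBl u v w : inner (u - v) w = inner u w - inner v w.
Proof. by rewrite innerDl innerNl. Qed.

Lemma innerBr u v w : inner u (v - w) = inner u v - inner u w.
Proof. by rewrite innerDr innerNr. Qed.

Lemma inner0l v : inner 0 v = 0.
Proof. by rewrite -(scale0r 0) innerZl mul0r. Qed.

Lemma inner_suml (I : Type) (r : seq I) (P : pred I) (F : I -> l2 R X) v :
  inner (\sum_(i <- r | P i) F i) v = \sum_(i <- r | P i) inner (F i) v.
Proof. by elim/big_rec2: _ => [|i y1 y2 _ <-]; rewrite ?inner0l// innerDl. Qed.

Lemma inner_self u : inner u u = (l2norm u ^+ 2)%:C%C.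
Proof.
apply: innerP; apply: has_sum_ext (has_sum_sqr u) => x.
by rewrite mul_conjc.
Qed.

Lemma inner_deltal u x : inner (delta R x) u = (u x)^*%C.
Proof. by rewrite innerC inner_delta. Qed.

Lemma inner_ext u v u' v' :
  (forall x, u x * (v x)^*%C = u' x * (v' x)^*%C) -> inner u v = inner u' v'.
Proof. by move=> h; apply: innerP; apply: has_sum_ext (inner_has_sum u' v'). Qed.

Lemma has_sum_normc_le f l (M : R) : has_sum f l ->
  (forall A, \sum_(x <- A) normc (f x) <= M) -> normc l <= M.
Proof.
move=> fl h; apply/ler_addgt0Pl => e e0; have [A hA] := fl e e0.
have := hA A (fsubset_refl A); rewrite normc_distC.
rewrite -{2}(subrK (\sum_(x <- A) f x) l) => h1.
apply: le_trans (normcD_le _ _) _; apply: lerD => //.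
by apply: le_trans (normc_sum _ _ _) _; exact: h.
Qed.

Lemma inner_normc_le u v (M : R) :
  (forall A, \sum_(x <- A) normc (u x) * normc (v x) <= M) ->
  normc (inner u v) <= M.
Proof.
move=> h; apply: (has_sum_normc_le (inner_has_sum u v)) => A.
by under eq_bigr do rewrite normcM normcJ.
Qed.

(** Deleting the coordinate [x] of [u] removes exactly one term of the inner product. This isolates
    a main term from its cross terms. *)
Lemma inner_near u v x (M : R) :
  (forall A, x \notin A -> \sum_(z <- A) normc (u z) * normc (v z) <= M) ->
  normc (inner u v - u x * (v x)^*%C) <= M.
Proof.
move=> h; have -> : inner u v - u x * (v x)^*%C = inner (u - u x *: delta R x) v.
  by rewrite innerBl innerZl inner_deltal.
apply: inner_normc_le => A; apply: le_trans (h (A `\ x)%fset _); last first.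
  by rewrite !inE eqxx.
set w := u - _.
have wE z : w z = if z == x then 0 else u z.
  rewrite /w l2B l2Z deltaE; case: eqP => [->|_]; first by rewrite mulr1 subrr.
  by rewrite mulr0 subr0.
clearbody w; rewrite [X in X <= _](bigID (pred1 x)) /= big1 ?add0r; last first.
  by move=> z zx; rewrite wE zx normc0 mul0r.
rewrite -big_filter le_eqVlt; apply/orP; left; apply/eqP.
rewrite (perm_big (enum_fset (A `\ x)%fset)) /=; last first.
  apply: uniq_perm; rewrite ?filter_uniq ?fset_uniq// => z.
  by rewrite mem_filter !inE.
apply: eq_big_seq => z; rewrite !inE => /andP[/negbTE zx _].
by rewrite wE zx.
Qed.

Lemma cauchy_schwarz_fin u v A :
  \sum_(x <- A) normc (u x) * normc (v x) <= l2norm u * l2norm v.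
Proof.
have [u0|u0] := eqVneq (l2norm u) 0.
  by rewrite (l2norm_eq0 u0) l2norm0 mul0r big1// => x _; rewrite l20 normc0 mul0r.
have [v0|v0] := eqVneq (l2norm v) 0.
  by rewrite (l2norm_eq0 v0) l2norm0 mulr0 big1// => x _; rewrite l20 normc0 mulr0.
set a := l2norm u in u0 *; set b := l2norm v in v0 *.
have a0 : 0 < a by rewrite lt_neqAle eq_sym u0 l2norm_ge0.
have b0 : 0 < b by rewrite lt_neqAle eq_sym v0 l2norm_ge0.
(* Young's inequality, weighted so that each of the two sums is at most [a * b / 2]. *)
apply: (@le_trans _ _ (\sum_(x <- A)
   (b / (2 * a) * normc (u x) ^+ 2 + a / (2 * b) * normc (v x) ^+ 2))).
  apply: ler_sum => x _; set s := normc (u x); set t := normc (v x).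
  rewrite -subr_ge0 (_ : _ - _ = (s * b - t * a) ^+ 2 / (2 * a * b)).
    by rewrite divr_ge0 ?sqr_ge0// !mulr_ge0// ltW.
  by field; rewrite u0 v0.
rewrite big_split /= -!mulr_sumr.
apply: (@le_trans _ _ (b / (2 * a) * a ^+ 2 + a / (2 * b) * b ^+ 2)).
  by apply: lerD; apply: ler_wpM2l; rewrite ?sum_le_l2norm// divr_ge0// ?mulr_ge0// ltW.
by rewrite le_eqVlt; apply/orP; left; apply/eqP; field; rewrite u0 v0.
Qed.

Lemma cauchy_schwarz u v : normc (inner u v) <= l2norm u * l2norm v.
Proof. by apply: inner_normc_le => A; exact: cauchy_schwarz_fin. Qed.

End unconditional_sums.

(** * Adjoints and the uniform Roe algebra *)

Section bounded_operators.
Context (R : realType) (X : choiceType).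
Implicit Types (u v w : l2 R X) (x z : X) (a b : bop (l2 R X)).
Implicit Types (A B : {fset X}) (e M : R).

Lemma bopE_D a b u : (a + b) u = a u + b u. Proof. by []. Qed.
Lemma bopE_B a b u : (a - b) u = a u - b u. Proof. by []. Qed.
Lemma bopE_Z k a u : (k *: a) u = k *: a u. Proof. by []. Qed.
Lemma bopE_M a b u : (a * b) u = a (b u). Proof. by []. Qed.
Lemma bopE_1 u : (1 : bop (l2 R X)) u = u. Proof. by []. Qed.
Lemma bopE_0 u : (0 : bop (l2 R X)) u = 0. Proof. by []. Qed.
Lemma bopE_sum (I : Type) (r : seq I) (P : pred I) (F : I -> bop (l2 R X)) u :
  (\sum_(i <- r | P i) F i) u = \sum_(i <- r | P i) F i u.
Proof. by elim/big_rec2: _ => [//|i c d _ <-]. Qed.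

Lemma bop_ext a b : (forall u, a u = b u) -> a = b.
Proof. by move=> ab; apply/val_inj/funext. Qed.

Lemma bopD a u v : a (u + v) = a u + a v.
Proof. by have := bop_linear a 1 u v; rewrite !scale1r. Qed.

Lemma bopN a u : a (- u) = - a u.
Proof. by rewrite -scaleN1r bopZ scaleN1r. Qed.

Lemma bopB a u v : a (u - v) = a u - a v.
Proof. by rewrite bopD bopN. Qed.

Lemma bop_sum a (I : Type) (r : seq I) (P : pred I) (F : I -> l2 R X) :
  a (\sum_(i <- r | P i) F i) = \sum_(i <- r | P i) a (F i).
Proof. by elim/big_rec2: _ => [|i c d _ <-]; rewrite ?bop0// bopD. Qed.

Lemma l2norm_bop_le a u : l2norm (a u) <= opnorm a * l2norm u.
Proof. by have := le_opnorm a u; rewrite !l2_normE -rmorphM lecR. Qed.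

Lemma opnorm_le_l2 a M : 0 <= M ->
  (forall u, l2norm (a u) <= M * l2norm u) -> opnorm a <= M.
Proof.
by move=> M0 h; apply: opnorm_le => // v; rewrite !l2_normE -rmorphM lecR.
Qed.

Lemma opnormD a b : opnorm (a + b) <= opnorm a + opnorm b.
Proof. by have := ler_normD a b; rewrite !bop_normE -rmorphD lecR. Qed.

Lemma opnormN a : opnorm (- a) = opnorm a.
Proof. by have := normrN a; rewrite !bop_normE => -[]. Qed.

Lemma opnorm0 : opnorm (0 : bop (l2 R X)) = 0.
Proof. by have := normr0 (bop (l2 R X)); rewrite bop_normE => -[]. Qed.

Lemma opnormB_sym a b : opnorm (a - b) = opnorm (b - a).
Proof. by rewrite -opprB opnormN. Qed.

Lemma opnormZ k a : opnorm (k *: a) = normc k * opnorm a.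
Proof.
have := normrZ k a; rewrite !bop_normE normcE -rmorphM => /eqP.
by rewrite eq_complex /= eqxx andbT => /eqP.
Qed.

Lemma opnormM a b : opnorm (a * b) <= opnorm a * opnorm b.
Proof.
apply: opnorm_le_l2 => [|u]; first by rewrite mulr_ge0 ?opnorm_ge0.
apply: le_trans (l2norm_bop_le a (b u)) _.
by rewrite -mulrA ler_wpM2l ?opnorm_ge0 ?l2norm_bop_le.
Qed.

Lemma opnorm_sum (I : Type) (r : seq I) (P : pred I) (F : I -> bop (l2 R X)) :
  opnorm (\sum_(i <- r | P i) F i) <= \sum_(i <- r | P i) opnorm (F i).
Proof.
elim/big_rec2: _ => [|i y1 y2 _ h]; first by rewrite opnorm0.
by apply: le_trans (opnormD _ _) _; rewrite lerD2l.
Qed.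

Lemma coefD a b x z : coef (a + b) x z = coef a x z + coef b x z.
Proof. by rewrite !coefE bopE_D l2D. Qed.

Lemma coefB a b x z : coef (a - b) x z = coef a x z - coef b x z.
Proof. by rewrite !coefE bopE_B l2B. Qed.

Lemma coefZ k a x z : coef (k *: a) x z = k * coef a x z.
Proof. by rewrite !coefE bopE_Z l2Z. Qed.

Lemma coef_sum (I : Type) (r : seq I) (P : pred I) (F : I -> bop (l2 R X)) x z :
  coef (\sum_(i <- r | P i) F i) x z = \sum_(i <- r | P i) coef (F i) x z.
Proof. by elim/big_rec2: _ => [|i c d _ <-]; rewrite ?coefE// coefD. Qed.

Lemma coef_le_opnorm a x z : normc (coef a x z) <= opnorm a.
Proof.
rewrite coefE; apply: le_trans (normc_le_l2norm _ _) _.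
by apply: le_trans (l2norm_bop_le _ _) _; rewrite l2norm_delta mulr1.
Qed.

Lemma le_eps_eq0 (k c : R) : 0 <= k -> (forall e, 0 < e -> k <= c * e) -> k = 0.
Proof.
move=> k0 h; apply/eqP; rewrite eq_le k0 andbT; apply/ler_addgt0Pr => e e0.
rewrite add0r; have c0 : 0 < `|c| + 1 by rewrite ltr_wpDl.
apply: le_trans (h (e / (`|c| + 1)) _) _; first by rewrite divr_gt0.
rewrite mulrCA ler_piMr ?(ltW e0)// ler_pdivrMr// mul1r.
by apply: le_trans (ler_norm _) _; rewrite lerDl.
Qed.

(** The difference kills every basis vector, hence every finitely supported vector, and these are
    dense. *)
Lemma bop_coef_ext a b : (forall x z, coef a x z = coef b x z) -> a = b.
Proof.
move=> ab; apply/subr0_eq; apply: bop_ext => u; apply: l2norm_eq0.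
apply: (@le_eps_eq0 _ (opnorm (a - b))) => [|e e0]; first exact: l2norm_ge0.
have [A /ltW hA] := l2_dense u e0.
rewrite -[X in (a - b) X](subrK (restrict_fun [set` A] u)) bopD.
rewrite [X in _ + X](_ : _ = 0) ?addr0; last first.
  rewrite restrict_fset_sum bop_sum big1// => x _; rewrite bopZ.
  rewrite (_ : (a - b) _ = 0) ?scaler0//; apply: l2_ext => z.
  by rewrite bopE_B l2B -!coefE ab subrr.
apply: le_trans (l2norm_bop_le _ _) _.
by rewrite ler_wpM2l ?opnorm_ge0.
Qed.

(** Duality: with [w] the combination of basis vectors of [A] with coefficients [c x], both
    [inner v (a w)] and [inner w w] equal [S], so Cauchy-Schwarz bounds [S] by the norms of [v] and
    [a] times the square root of [S]. This bound makes the adjoint, defined entrywise below, a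
    bounded operator on [l2]. *)
Lemma adjoint_sum_le a v A :
  \sum_(x <- A) normc (inner v (a (delta R x))) ^+ 2 <=
  (opnorm a * l2norm v) ^+ 2.
Proof.
set c := fun x => inner v (a (delta R x)).
set S := \sum_(x <- A) _.
have S0 : 0 <= S by apply: sumr_ge0 => x _; exact: sqr_ge0.
pose w : l2 R X := \sum_(x <- A) c x *: delta R x.
have wE x : x \in A -> w x = c x.
  move=> xA; rewrite l2_sum; under eq_bigr do rewrite l2Z deltaE.
  rewrite (bigD1_seq x)//= eqxx mulr1 big1 ?addr0// => z /negbTE.
  by rewrite eq_sym => ->; rewrite mulr0.
have wS : l2norm w = Num.sqrt S.
  have : inner w w = S%:C%C.
    rewrite {1}/w inner_suml rmorph_sum; apply: eq_big_seq => x xA.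
    by rewrite innerZl inner_deltal wE// mul_conjc.
  rewrite inner_self => -[] <-; by rewrite sqrtr_sqr ger0_norm ?l2norm_ge0.
have : inner v (a w) = S%:C%C.
  rewrite bop_sum innerC inner_suml (_ : \sum_(x <- A) _ = S%:C%C).
    by rewrite /= oppr0.
  rewrite rmorph_sum; apply: eq_bigr => x _.
  by rewrite bopZ innerZl innerC mul_conjc.
move=> /(congr1 (@normc R)); rewrite normc_real// => SE.
have : S <= l2norm v * (opnorm a * Num.sqrt S).
  rewrite -{1}SE -wS; apply: le_trans (cauchy_schwarz _ _) _.
  by rewrite ler_wpM2l ?l2norm_ge0 ?l2norm_bop_le.
have [S00|Sn0] := eqVneq S 0; first by rewrite S00 sqr_ge0.
have sS : 0 < Num.sqrt S by rewrite sqrtr_gt0 lt_neqAle eq_sym Sn0.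
rewrite mulrA -{1}(sqr_sqrtr S0) expr2 ler_pM2r// mulrC => h.
by rewrite -(sqr_sqrtr S0) lerXn2r ?nnegrE ?sqrtr_ge0// mulr_ge0 ?opnorm_ge0 ?l2norm_ge0.
Qed.

Fact adj_l2 a v : (fun x => inner v (a (delta R x)) : R[i]^o) \in @l2_pred R X.
Proof. by apply: l2_mem => A; exact: adjoint_sum_le. Qed.

Definition adj_fun a v : l2 R X := L2 (adj_l2 a v).

Lemma adj_funE a v x : adj_fun a v x = inner v (a (delta R x)).
Proof. by []. Qed.

Lemma adj_fun_norm a v : l2norm (adj_fun a v) <= opnorm a * l2norm v.
Proof.
apply: l2norm_le => [|A]; first by rewrite mulr_ge0 ?opnorm_ge0 ?l2norm_ge0.
exact: adjoint_sum_le.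
Qed.

Fact adj_bop a : adj_fun a \in @bop_pred R (l2 R X).
Proof.
apply/bop_predP; split=> [k u v|].
  by apply: l2_ext => x; rewrite l2D l2Z !adj_funE innerDl innerZl.
by exists (opnorm a) => u; rewrite !l2_normE -rmorphM lecR adj_fun_norm.
Qed.

Definition adj a : bop (l2 R X) := Bop (adj_bop a).

Lemma adjE a v x : adj a v x = inner v (a (delta R x)). Proof. by []. Qed.

Lemma opnorm_adj_le a : opnorm (adj a) <= opnorm a.
Proof. by apply: opnorm_le_l2 (opnorm_ge0 _) _ => u; exact: adj_fun_norm. Qed.

Lemma coef_adj a x z : coef (adj a) x z = conjc (coef a z x).
Proof. by rewrite coefE adjE inner_deltal -coefE. Qed.

(** A finite partial sum of the right-hand side is [inner] of [a] applied to a truncation of [u],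
    and truncations converge to [u]. *)
Lemma adjP a : adjoint_of a (adj a).
Proof.
move=> u v; apply/esym/innerP => e e0.
have K0 : 0 < opnorm a * l2norm v + 1.
  by rewrite ltr_wpDl// mulr_ge0 ?opnorm_ge0 ?l2norm_ge0.
have [|A hA] := @l2_dense_up R X u (e / (opnorm a * l2norm v + 1)).
  by rewrite divr_gt0.
exists A => B /hA/ltW h.
have -> : \sum_(x <- B) u x * (adj a v x)^*%C =
    inner (a (restrict_fun [set` B] u)) v.
  rewrite restrict_fset_sum bop_sum inner_suml; apply: eq_bigr => x _.
  by rewrite bopZ innerZl adjE -innerC.
rewrite -innerBl -bopB; apply: le_trans (cauchy_schwarz _ _) _.
apply: le_trans (_ : (opnorm a * (e / (opnorm a * l2norm v + 1))) * l2norm v <= _).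
  rewrite ler_wpM2r ?l2norm_ge0//; apply: le_trans (l2norm_bop_le _ _) _.
  by rewrite ler_wpM2l ?opnorm_ge0// l2normB_sym.
rewrite mulrAC mulrA ler_pdivrMr// [X in _ <= X]mulrC.
by rewrite ler_wpM2r ?(ltW e0)// lerDl.
Qed.

Lemma coef_adjoint_of a b x z :
  adjoint_of a b -> coef b x z = conjc (coef a z x).
Proof.
move=> ab; rewrite /coef ab inner_deltal -[b (delta R z) x]inner_delta.
by rewrite conjcK.
Qed.

Lemma adjoint_of_adj a b : adjoint_of a b -> b = adj a.
Proof.
by move=> ab; apply: bop_coef_ext => x z; rewrite (coef_adjoint_of _ _ ab) coef_adj.
Qed.

Lemma adjoint_ofP a b :
  (forall x z, coef b x z = conjc (coef a z x)) -> adjoint_of a b.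
Proof.
move=> h; suff -> : b = adj a by exact: adjP.
by apply: bop_coef_ext => x z; rewrite h coef_adj.
Qed.

Lemma bopE_inner a u x : a u x = inner u (adj a (delta R x)).
Proof. by rewrite -adjP inner_delta. Qed.

(** Lower semicontinuity of the norm under entrywise approximation. A compression to a finite set on
    both sides sees finitely many entries ([fin]); letting the truncation of the input grow gives
    [part], and letting that of the output grow gives the claim. *)
Lemma opnorm_le_coefs a M : 0 <= M ->
  (forall e A, 0 < e -> exists2 b, opnorm b <= M &
     forall x z, x \in A -> z \in A -> normc (coef a x z - coef b x z) <= e) ->
  opnorm a <= M.
Proof.
move=> M0 h.
have fin A u : l2norm (restrict_fun [set` A] (a (restrict_fun [set` A] u)))
    <= M * l2norm u.
  pose n := (size A)%:R : R; apply/ler_addgt0Pr => e e0.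
  pose K := n * (n * l2norm u) + 1.
  have K0 : 0 < K by rewrite ltr_wpDl// !mulr_ge0 ?ler0n ?l2norm_ge0.
  have [|b bM hb] := h (e / K) A; first by rewrite divr_gt0.
  set v := restrict_fun [set` A] u.
  have -> : restrict_fun [set` A] (a v) =
      restrict_fun [set` A] (b v) + restrict_fun [set` A] ((a - b) v).
    apply: l2_ext => x; rewrite l2D !restrict_funE; case: ifP => _.
      by rewrite bopE_B l2B addrC subrK.
    by rewrite addr0.
  apply: le_trans (l2normD _ _) _; apply: lerD.
    apply: le_trans (l2norm_restrict_le _ _) _.
    apply: le_trans (l2norm_bop_le _ _) _.
    by apply: ler_pM => //; rewrite ?opnorm_ge0 ?l2norm_ge0 ?l2norm_restrict_le.
  apply: (@le_trans _ _ (n * (n * (e / K * l2norm u)))); last first.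
    have -> : n * (n * (e / K * l2norm u)) = (K - 1) * (e / K).
      by rewrite /K addrK; ring.
    rewrite mulrCA ler_piMr ?(ltW e0)// ler_pdivrMr// mul1r lerBlDr lerDl//.
  rewrite [X in l2norm X]restrict_fset_sum; apply: le_trans (l2norm_sum _ _ _) _.
  rewrite big_seq.
  apply: (@le_trans _ _ (\sum_(x <- A | x \in A) (n * (e / K * l2norm u)))); last first.
    by rewrite -big_seq big_const_seq count_predT iter_addr addr0 -mulr_natl.
  apply: ler_sum => x xA; rewrite l2normZ l2norm_delta mulr1.
  rewrite /v restrict_fset_sum bop_sum l2_sum; apply: le_trans (normc_sum _ _ _) _.
  rewrite big_seq.
  apply: (@le_trans _ _ (\sum_(z <- A | z \in A) (e / K * l2norm u))); last first.
    by rewrite -big_seq big_const_seq count_predT iter_addr addr0 -mulr_natl.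
  apply: ler_sum => z zA; rewrite bopZ l2Z normcM mulrC -coefE coefB.
  by apply: ler_pM => //; rewrite ?normc_ge0 ?hb ?normc_le_l2norm.
have part A u : l2norm (restrict_fun [set` A] (a u)) <= M * l2norm u.
  apply/ler_addgt0Pr => e e0.
  have K0 : 0 < opnorm a + 1 by rewrite ltr_wpDl ?opnorm_ge0.
  have [|B hB] := @l2_dense_up R X u (e / (opnorm a + 1)); first by rewrite divr_gt0.
  set C := (A `|` B)%fset.
  have -> : a u = a (restrict_fun [set` C] u) + a (u - restrict_fun [set` C] u).
    by rewrite -bopD addrC subrK.
  have -> v w : restrict_fun [set` A] (v + w) =
      restrict_fun [set` A] v + restrict_fun [set` A] w.
    by apply: l2_ext => x; rewrite l2D !restrict_funE; case: ifP; rewrite ?addr0.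
  apply: le_trans (l2normD _ _) _; apply: lerD.
    apply: le_trans (fin C u).
    rewrite (_ : restrict_fun [set` A] (a _) = restrict_fun [set` A]
       (restrict_fun [set` C] (a (restrict_fun [set` C] u)))).
      exact: l2norm_restrict_le.
    apply: l2_ext => x; rewrite !restrict_funE !mem_setE in_fsetU.
    by case: (x \in A).
  apply: le_trans (l2norm_restrict_le _ _) _; apply: le_trans (l2norm_bop_le _ _) _.
  apply: (@le_trans _ _ ((opnorm a + 1) * (e / (opnorm a + 1)))).
    apply: ler_pM; rewrite ?opnorm_ge0 ?l2norm_ge0 ?lerDl//.
    by apply/ltW/hB; exact: fsubsetUr.
  by rewrite mulrCA mulfV ?mulr1// gt_eqF.
apply: opnorm_le_l2 => // u; apply/ler_addgt0Pr => e e0.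
have [A /ltW hA] := l2_dense (a u) e0.
rewrite -(subrK (restrict_fun [set` A] (a u)) (a u)) addrC.
by apply: le_trans (l2normD _ _) _; apply: lerD.
Qed.

End bounded_operators.

Section matrix_units.
Context (R : realType) (X : choiceType).
Implicit Types (u v w : l2 R X) (x z : X) (a b : bop (l2 R X)).

Fact rank1_bop u v : (fun w => inner w v *: u) \in @bop_pred R (l2 R X).
Proof.
apply/bop_predP; split=> [k w1 w2|].
  by rewrite innerDl innerZl scalerDl scalerA.
exists (l2norm v * l2norm u) => w.
rewrite !l2_normE -rmorphM lecR l2normZ mulrAC ler_wpM2r ?l2norm_ge0//.
by rewrite mulrC; exact: cauchy_schwarz.
Qed.

Definition rank1 u v : bop (l2 R X) := Bop (rank1_bop u v).

Lemma rank1E u v w : rank1 u v w = inner w v *: u. Proof. by []. Qed.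

Lemma coef_rank1 u v x z : coef (rank1 u v) x z = u x * conjc (v z).
Proof. by rewrite coefE rank1E inner_deltal l2Z mulrC. Qed.

Definition munit x z := rank1 (delta R x) (delta R z).

Lemma munitE x z w : munit x z w = w z *: delta R x.
Proof. by rewrite /munit rank1E inner_delta. Qed.

Lemma coef_munit x z x' z' :
  coef (munit x z) x' z' = (x' == x)%:R * (z' == z)%:R.
Proof.
by rewrite coef_rank1 !deltaE (eq_sym z'); case: (z == z'); rewrite ?rmorph1 ?rmorph0.
Qed.

Lemma adjoint_munit x z : adjoint_of (munit x z) (munit z x).
Proof.
apply: adjoint_ofP => x' z'; rewrite !coef_rank1 conjcM conjcK mulrC.
by rewrite !deltaE.
Qed.

Lemma munit_mul x z (w : X) : munit x z * munit z w = munit x w.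
Proof.
apply: bop_ext => u; rewrite bopE_M !munitE l2Z deltaE eqxx mulr1.
by [].
Qed.

Lemma munit_sandwich x z a x' z' :
  munit x z * a * munit x' z' = coef a z x' *: munit x z'.
Proof.
apply: bop_ext => u; rewrite !bopE_M bopE_Z !munitE bopZ l2Z coefE.
by rewrite scalerA mulrC.
Qed.

Lemma chi1_munit x : chi R [set x] = munit x x.
Proof.
apply: bop_ext => u; rewrite munitE; apply: l2_ext => z.
rewrite l2Z deltaE [LHS]restrict_funE.
have [->|zx] := eqVneq z x; first by rewrite mem_set// mulr1.
by rewrite mulr0 memNset// => /= /eqP; exact/negP.
Qed.

End matrix_units.

(** * Closure properties of the uniform Roe algebra *)

Section roe_algebra.
Context (R : realType) (X : choiceType) (EX : coarseStructure X).
Implicit Types (u v w : l2 R X) (x z : X) (a b : bop (l2 R X)) (e d : R).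

Lemma uRoeP a : uRoe EX a <->
  forall e, 0 < e -> exists2 b, entourages EX (supp b) & opnorm (a - b) <= e.
Proof.
split=> [h e e0|h B /nbhs_ballP[[er ei] /= e0 eB]].
  have [|b [/= bE ab]] := h (ball a e%:C%C).
    by apply: nbhsx_ballx; rewrite (@ltcR R 0).
  exists b => //; move: ab; rewrite -ball_normE /ball_ /= bop_normE ltcR.
  exact: ltW.
have [ei0 er0] : ei = 0 /\ 0 < er.
  by move: e0; rewrite ltcE /= => /andP[/eqP -> ->].
have [|b bE ab] := h (er / 2); first by rewrite divr_gt0.
exists b; split=> //; apply: eB; rewrite -ball_normE /ball_ /= bop_normE ei0.
rewrite ltcR; apply: le_lt_trans ab _.
by rewrite ltr_pdivrMr// ltr_pMr// ltr1n.
Qed.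

Lemma uRoe_fin a : entourages EX (supp a) -> uRoe EX a.
Proof. by move=> aE; apply: subset_closure. Qed.

Lemma suppP a x z : supp a (x, z) <-> coef a x z != 0.
Proof. by []. Qed.

Lemma uRoeD a b : uRoe EX a -> uRoe EX b -> uRoe EX (a + b).
Proof.
move=> /uRoeP ha /uRoeP hb; apply/uRoeP => e e0.
have e20 : 0 < e / 2 by rewrite divr_gt0.
have [a' aE aa'] := ha _ e20; have [b' bE bb'] := hb _ e20.
exists (a' + b').
  apply: entourages_sub (entourages_union aE bE) => -[x z].
  move=> /suppP; rewrite coefD => h; have [a0|a0] := eqVneq (coef a' x z) 0.
    by right; apply/suppP; move: h; rewrite a0 add0r.
  by left; apply/suppP.
rewrite opprD addrACA (splitr e).
by apply: le_trans (opnormD _ _) _; exact: lerD.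
Qed.

Lemma uRoeZ k a : uRoe EX a -> uRoe EX (k *: a).
Proof.
move=> /uRoeP ha; apply/uRoeP => e e0.
have k0 : 0 < normc k + 1 by rewrite ltr_wpDl ?normc_ge0.
have [|a' aE aa'] := ha (e / (normc k + 1)); first by rewrite divr_gt0.
exists (k *: a').
  apply: entourages_sub aE => -[x z]; rewrite /= !suppP coefZ.
  by apply: contra_neq => ->; rewrite mulr0.
rewrite -scalerBr opnormZ.
apply: le_trans (_ : (normc k + 1) * (e / (normc k + 1)) <= _); last first.
  by rewrite mulrCA mulfV ?mulr1// gt_eqF.
by apply: ler_pM => //; rewrite ?normc_ge0 ?opnorm_ge0// lerDl.
Qed.

Lemma uRoeN a : uRoe EX a -> uRoe EX (- a).
Proof. by rewrite -scaleN1r; exact: uRoeZ. Qed.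

Lemma uRoeB a b : uRoe EX a -> uRoe EX b -> uRoe EX (a - b).
Proof. by move=> ha hb; apply: uRoeD ha _; exact: uRoeN. Qed.

Lemma uRoe0 : uRoe EX (0 : bop (l2 R X)).
Proof.
apply: uRoe_fin; apply: entourages_sub (entourages_diag EX) => -[x z].
by rewrite suppP coefE bopE_0 l20 eqxx.
Qed.

Lemma uRoe_sum (I : Type) (r : seq I) (P : pred I) (F : I -> bop (l2 R X)) :
  (forall i, uRoe EX (F i)) -> uRoe EX (\sum_(i <- r | P i) F i).
Proof.
by move=> h; elim/big_rec: _ => [|i y _ hy]; [exact: uRoe0|exact: uRoeD].
Qed.

Lemma uRoe1 : uRoe EX (1 : bop (l2 R X)).
Proof.
apply: uRoe_fin; apply: entourages_sub (entourages_diag EX) => -[x z].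
rewrite suppP coefE bopE_1 deltaE /diagonal /=.
by case: (eqVneq x z) => // _; rewrite eqxx.
Qed.

Lemma supp_mul a b : supp (a * b) `<=` (supp b \; supp a)%relation.
Proof.
move=> [x z]; rewrite suppP => h; apply: contrapT => nh; move/negP: h; apply.
apply/eqP; rewrite coefE bopE_M bopE_inner.
rewrite -(inner0l (0 : l2 R X)).
apply: inner_ext => w; rewrite l20 mul0r -!coefE coef_adj conjcK.
have [->|bn0] := eqVneq (coef b w z) 0; first by rewrite mul0r.
have [->|an0] := eqVneq (coef a x w) 0; first by rewrite mulr0.
by exfalso; apply: nh; exists w.
Qed.

Lemma uRoeM a b : uRoe EX a -> uRoe EX b -> uRoe EX (a * b).
Proof.
move=> /uRoeP ha /uRoeP hb; apply/uRoeP => e e0.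
pose K := opnorm a + 1 + (opnorm b + 1).
have K0 : 0 < K by rewrite addr_gt0// ltr_wpDl ?opnorm_ge0.
pose d := Num.min 1 (e / K).
have d0 : 0 < d by rewrite lt_min ltr01 divr_gt0.
have [a' aE aa'] := ha _ d0; have [b' bE bb'] := hb _ d0.
exists (a' * b').
  exact: entourages_sub (@supp_mul _ _) (entourages_comp aE bE).
have -> : a * b - a' * b' = a * (b - b') + (a - a') * b'.
  by rewrite mulrBr mulrBl addrA subrK.
have b'n : opnorm b' <= opnorm b + 1.
  rewrite -(subrK b b') addrC; apply: le_trans (opnormD _ _) _.
  rewrite lerD2l opnormB_sym; apply: le_trans bb' _.
  by rewrite ge_min lexx.
apply: le_trans (opnormD _ _) _.
apply: (@le_trans _ _ ((opnorm a + 1) * d + (opnorm b + 1) * d)).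
  apply: lerD; apply: le_trans (opnormM _ _) _.
    by apply: ler_pM => //; rewrite ?opnorm_ge0 ?lerDl.
  by rewrite mulrC; apply: ler_pM => //; rewrite ?opnorm_ge0.
rewrite -mulrDl -/K mulrC -ler_pdivlMr//.
by rewrite /d ge_min lexx orbT.
Qed.

Lemma uRoe_adj a : uRoe EX a -> uRoe EX (adj a).
Proof.
move=> /uRoeP ha; apply/uRoeP => e /ha[b bE ab].
exists (adj b).
  apply: entourages_sub (entourages_inv bE) => -[x z].
  move=> /suppP; rewrite coef_adj => h; apply/suppP; apply: contra_neq h => ->.
  exact: rmorph0.
rewrite (_ : adj a - adj b = adj (a - b)).
  exact: le_trans (opnorm_adj_le _) ab.
by apply: bop_coef_ext => x z; rewrite coefB !coef_adj coefB conjcD conjcN.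
Qed.

Lemma uRoe_closed a :
  (forall e, 0 < e -> exists2 b, uRoe EX b & opnorm (a - b) <= e) -> uRoe EX a.
Proof.
move=> h; apply/uRoeP => e e0; have e20 : 0 < e / 2 by rewrite divr_gt0.
have [b /uRoeP/(_ _ e20)[c cE bc] ab] := h _ e20.
exists c => //; rewrite -(subrK b a) -addrA (splitr e).
by apply: le_trans (opnormD _ _) _; exact: lerD.
Qed.

(** An approximant within [d / 2] whose support is an entourage cannot vanish where the entry of [a]
    has modulus at least [d]. This is how entourages are read off from operators. *)
Lemma entourages_coef_ge a d : uRoe EX a -> 0 < d ->
  entourages EX [set xz | d <= normc (coef a xz.1 xz.2)].
Proof.
move=> /uRoeP ha d0; have [|b bE ab] := ha (d / 2); first by rewrite divr_gt0.
apply: entourages_sub bE => -[x z] /= h; rewrite suppP; apply/eqP => b0.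
have := le_trans (coef_le_opnorm (a - b) x z) ab.
rewrite coefB b0 subr0 => /(le_trans h).
by rewrite leNgt ltr_pdivrMr// ltr_pMr// ltr1n.
Qed.

(** Connectedness puts all matrix units into the Roe algebra. *)
Definition coarsely_connected := forall x z, entourages EX [set (x, z)].

Lemma uRoe_munit x z : coarsely_connected -> uRoe EX (munit R x z).
Proof.
move=> cX; apply: uRoe_fin; apply: entourages_sub (cX x z) => -[x' z'].
move=> /suppP; rewrite coef_munit /=.
case: (eqVneq x' x) => [->|_]; last by rewrite mul0r eqxx.
by case: (eqVneq z' z) => [->//|_]; rewrite mulr0 eqxx.
Qed.

End roe_algebra.

(** * Isomorphisms are spatial *)

Section star_isomorphisms.
Context (R : realType) (X Y : choiceType).
Context (EX : coarseStructure X) (EY : coarseStructure Y).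
Context (Phi : bop (l2 R X) -> bop (l2 R Y)).
Hypothesis iso : star_isomorphism EX EY Phi.
Implicit Types (a b : bop (l2 R X)).

Lemma iso_mem a : uRoe EX a -> uRoe EY (Phi a).
Proof. by case: iso => -[+ _ _] _ _ _ _; apply. Qed.

Lemma isoD a b : uRoe EX a -> uRoe EX b -> Phi (a + b) = Phi a + Phi b.
Proof. by case: iso => _ h _ _ _ /mem_set ha /mem_set hb; exact: h. Qed.

Lemma isoZ k a : uRoe EX a -> Phi (k *: a) = k *: Phi a.
Proof. by case: iso => _ _ h _ _ /mem_set ha; exact: h. Qed.

Lemma isoM a b : uRoe EX a -> uRoe EX b -> Phi (a * b) = Phi a * Phi b.
Proof. by case: iso => _ _ _ h _ /mem_set ha /mem_set hb; exact: h. Qed.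

Lemma iso_adjoint a b : uRoe EX a -> uRoe EX b ->
  adjoint_of a b -> adjoint_of (Phi a) (Phi b).
Proof. by case: iso => _ _ _ _ h /mem_set ha /mem_set hb; exact: h. Qed.

Lemma iso0 : Phi 0 = 0.
Proof. by rewrite -(scale0r 0) isoZ ?scale0r//; exact: uRoe0. Qed.

Lemma iso_inj a b : uRoe EX a -> uRoe EX b -> Phi a = Phi b -> a = b.
Proof. by case: iso => -[_ h _] _ _ _ _ /mem_set ha /mem_set hb; exact: h. Qed.

Local Notation Psi := (iso_inv EX Phi).

Lemma iso_invKV c : uRoe EY c -> Phi (Psi c) = c.
Proof.
case: iso => -[_ _ hs] _ _ _ _ cY; rewrite /iso_inv pinvK// mem_set//.
exact: hs.
Qed.

Lemma iso_inv_mem c : uRoe EY c -> uRoe EX (Psi c).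
Proof.
case: iso => hb _ _ _ _.
by have [h _ _] := bijpinv_bij (fun=> 0 : bop (l2 R X)) hb; apply: h.
Qed.

Lemma iso_invK a : uRoe EX a -> Psi (Phi a) = a.
Proof.
move=> ha; apply: iso_inj; rewrite ?iso_invKV//; last exact: iso_mem.
by apply: iso_inv_mem; exact: iso_mem.
Qed.

Lemma star_isomorphism_inv : star_isomorphism EY EX Psi.
Proof.
split.
- by case: iso => hb _ _ _ _; exact: bijpinv_bij.
- move=> c d /set_mem cY /set_mem dY; have mc := iso_inv_mem cY.
  have md := iso_inv_mem dY; apply: iso_inj; [|exact: uRoeD|].
    by apply: iso_inv_mem; exact: uRoeD.
  by rewrite iso_invKV ?isoD ?iso_invKV//; exact: uRoeD.
- move=> k c /set_mem cY; have mc := iso_inv_mem cY.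
  apply: iso_inj; [|exact: uRoeZ|].
    by apply: iso_inv_mem; exact: uRoeZ.
  by rewrite iso_invKV ?isoZ ?iso_invKV//; exact: uRoeZ.
- move=> c d /set_mem cY /set_mem dY; have mc := iso_inv_mem cY.
  have md := iso_inv_mem dY; apply: iso_inj; [|exact: uRoeM|].
    by apply: iso_inv_mem; exact: uRoeM.
  by rewrite iso_invKV ?isoM ?iso_invKV//; exact: uRoeM.
- move=> c d /set_mem cY /set_mem dY cd; have mc := iso_inv_mem cY.
  have md := iso_inv_mem dY; have mcs := uRoe_adj mc.
  (* Adjoints are unique, so it is enough that both sides have the same image under [Phi]. *)
  suff -> : Psi d = adj (Psi c) by exact: adjP.
  apply: iso_inj => //; rewrite iso_invKV//.
  have := iso_adjoint mc mcs (@adjP _ _ _); rewrite iso_invKV// => /adjoint_of_adj ->.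
  exact: adjoint_of_adj.
Qed.

Lemma iso1 : Phi 1 = 1.
Proof.
have h1 := @uRoe1 R Y EY; have p1 := iso_inv_mem h1.
have := isoM (@uRoe1 R X EX) p1.
by rewrite mul1r iso_invKV// mulr1.
Qed.

End star_isomorphisms.

Section spatial_kernel.
Context (R : realType).

Section one_direction.
Context (X Y : choiceType) (EX : coarseStructure X) (EY : coarseStructure Y).
Context (Phi : bop (l2 R X) -> bop (l2 R Y)) (Psi : bop (l2 R Y) -> bop (l2 R X)).
Hypothesis isoPhi : star_isomorphism EX EY Phi.
Hypothesis isoPsi : star_isomorphism EY EX Psi.
Hypothesis PhiK : forall a, uRoe EX a -> Psi (Phi a) = a.
Hypothesis cY : coarsely_connected EY.

(** Apply [Psi] to the identity expressing [munit y0 y * Phi a * munit y' y0] as a multiple of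
    [munit y0 y0], read the entry at [(x0, x0)] and move the left factor across the inner product.
    Up to a scalar, [Phi a] is thus the matrix of [a] in the vectors
    [Psi (munit y y0) (delta x0)]. *)
Lemma iso_coef (x0 : X) (y0 y y' : Y) a : uRoe EX a ->
  coef (Psi (munit R y0 y0)) x0 x0 * coef (Phi a) y y' =
  inner (a (Psi (munit R y' y0) (delta R x0))) (Psi (munit R y y0) (delta R x0)).
Proof.
move=> aX; have aY := iso_mem isoPhi aX.
have m z z' := @uRoe_munit R Y EY z z' cY.
have mm := uRoeM (m y0 y) aY.
have := congr1 Psi (munit_sandwich y0 y (Phi a) y' y0).
rewrite (isoM isoPsi)// (isoM isoPsi)// PhiK// (isoZ isoPsi)//.
move=> /(congr1 (fun b => coef b x0 x0)); rewrite coefZ mulrC => <-.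
rewrite /coef !bopE_M.
exact: (iso_adjoint isoPsi (m y0 y) (m y y0) (@adjoint_munit R Y y0 y)).
Qed.

Lemma iso_nonzero a : uRoe EX a -> a != 0 -> Phi a != 0.
Proof.
move=> aX; apply: contra_neq => a0; rewrite -(PhiK aX) a0; exact: iso0 isoPsi.
Qed.

End one_direction.

Lemma bop_neq0 (X : choiceType) (a : bop (l2 R X)) : a != 0 ->
  exists x z, coef a x z != 0.
Proof.
move=> a0; apply: contrapT => /forallNP h; move/eqP: a0; apply.
apply: bop_coef_ext => x z; rewrite [RHS]coefE bopE_0 l20.
by have /forallNP/(_ z)/negP := h x; rewrite negbK => /eqP.
Qed.

Lemma munit_neq0 (X : choiceType) (x z : X) : munit R x z != 0.
Proof.
apply/eqP => /(congr1 (fun a => coef a x z)); rewrite coef_munit !eqxx mulr1.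
by rewrite coefE bopE_0 l20 => /eqP; rewrite oner_eq0.
Qed.

(** A diagonal entry of a projection is the squared norm of the corresponding column. *)
Lemma projection_diag_neq0 (X : choiceType) (p : bop (l2 R X)) :
  is_projection p -> p != 0 -> exists x, coef p x x != 0.
Proof.
move=> [pp ps] /bop_neq0[z [x pzx]]; exists x.
have -> : coef p x x = (l2norm (p (delta R x)) ^+ 2)%:C%C.
  by rewrite -inner_self ps -[p (p _)]bopE_M pp -ps.
rewrite eq_complex /= eqxx andbT sqrf_eq0; apply/eqP => /l2norm_eq0 p0.
by move/eqP: pzx; apply; rewrite coefE p0.
Qed.

Context (X Y : choiceType) (EX : coarseStructure X) (EY : coarseStructure Y).
Context (Phi : bop (l2 R X) -> bop (l2 R Y)) (Psi : bop (l2 R Y) -> bop (l2 R X)).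
Hypothesis isoPhi : star_isomorphism EX EY Phi.
Hypothesis isoPsi : star_isomorphism EY EX Psi.
Hypothesis PhiK : forall a, uRoe EX a -> Psi (Phi a) = a.
Hypothesis PsiK : forall b, uRoe EY b -> Phi (Psi b) = b.
Hypothesis cX : coarsely_connected EX.

(* Corners of C*_u(Y) at points in distinct coarse components vanish, while
   p e q <> 0 for some matrix unit e whenever p, q are nonzero in C*_u(X). *)
Lemma iso_connected : coarsely_connected EY.
Proof.
move=> y y'; have m w : uRoe EY (munit R w w) by rewrite -chi1_munit; exact: chi_uRoe.
have n w : Psi (munit R w w) != 0.
  by apply: (iso_nonzero isoPhi PsiK) => //; exact: munit_neq0.
have [z [x zx]] := bop_neq0 (n y); have [x' [z' x'z']] := bop_neq0 (n y').
have hm := @uRoe_munit R X EX x x' cX.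
pose b := Phi (munit R x x').
have bY : uRoe EY b by exact: iso_mem hm.
have [b0|b0] := eqVneq (coef b y y') 0.
  have := munit_sandwich y y b y' y'.
  rewrite b0 scale0r => /(congr1 Psi).
  have mb := uRoeM (m y) bY.
  rewrite (isoM isoPsi)// (isoM isoPsi)// PhiK// (iso0 isoPsi).
  move=> /(congr1 (fun a => coef a z z')).
  rewrite [RHS]coefE bopE_0 l20 coefE !bopE_M munitE bopZ l2Z -!coefE => /eqP.
  by rewrite mulf_eq0 (negbTE zx) (negbTE x'z').
have d0 : 0 < normc (coef b y y').
  rewrite lt_neqAle normc_ge0 andbT eq_sym; apply: contra_neq b0; exact: normc_eq0.
by apply: entourages_sub (entourages_coef_ge bY d0) => _ -> /=.
Qed.

(* [xi] and [eta] are the columns of a unitary implementing [Phi]. *)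
Definition spatial_kernel (xi : Y -> l2 R X) (eta : X -> l2 R Y) :=
  [/\ forall x y, eta x y = conjc (xi y x),
      (forall y, l2norm (xi y) = 1) /\ (forall x, l2norm (eta x) = 1),
      forall a y y', uRoe EX a -> coef (Phi a) y y' = inner (a (xi y')) (xi y) &
      forall b x x', uRoe EY b -> coef (Psi b) x x' = inner (b (eta x')) (eta x)].

Lemma spatial_kernel_exists : exists xi eta, spatial_kernel xi eta.
Proof.
have cY := iso_connected.
(* If [X] is empty then so is [Y]: the image under [Psi] of a matrix unit would have a nonzero
   entry. Otherwise a base point is available. *)
have [[x0 _]|X0] := pselect (exists x : X, True); last first.
  have Y0 (y : Y) : False.
    have m : uRoe EY (munit R y y) by rewrite -chi1_munit; exact: chi_uRoe.
    have /bop_neq0[x _] := iso_nonzero isoPhi PsiK m (munit_neq0 _ _).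
    by apply: X0; exists x.
  exists (fun=> 0), (fun=> 0); split.
  - by move=> x y; case: (Y0 y).
  - by split=> [y|x]; [case: (Y0 y)|case: X0; exists x].
  - by move=> a y; case: (Y0 y).
  - by move=> a x; case: X0; exists x.
have mX z z' := @uRoe_munit R X EX z z' cX.
have mY z z' := @uRoe_munit R Y EY z z' cY.
have [y0 c0] : exists y0, coef (Phi (munit R x0 x0)) y0 y0 != 0.
  apply: projection_diag_neq0; last first.
    by apply: (iso_nonzero isoPsi PhiK) => //; exact: munit_neq0.
  split; first by rewrite -(isoM isoPhi)// munit_mul.
  by apply: (iso_adjoint isoPhi) => //; exact: adjoint_munit.
pose v y := Psi (munit R y y0) (delta R x0).
pose w x := Phi (munit R x x0) (delta R y0).
set c := coef _ _ _ in c0.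
pose c' := coef (Psi (munit R y0 y0)) x0 x0.
have Fv a y y' : uRoe EX a -> c' * coef (Phi a) y y' = inner (a (v y')) (v y).
  exact: (iso_coef isoPhi isoPsi PhiK cY).
have Fw b x x' : uRoe EY b -> c * coef (Psi b) x x' = inner (b (w x')) (w x).
  exact: (iso_coef isoPsi isoPhi PsiK cX).
have c'E y : c' = (l2norm (v y) ^+ 2)%:C%C.
  rewrite -inner_self -{1}[v y]bopE_1 -Fv; last exact: uRoe1.
  by rewrite (iso1 isoPhi) coefE bopE_1 deltaE eqxx mulr1.
have cE x : c = (l2norm (w x) ^+ 2)%:C%C.
  rewrite -inner_self -{1}[w x]bopE_1 -Fw; last exact: uRoe1.
  by rewrite (iso1 isoPsi) coefE bopE_1 deltaE eqxx mulr1.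
(* Evaluating both formulas at matrix units shows that [v] and [w] are conjugate transposes up to
   the factors [c'] and [c]. The entry at [(x0, y0)] of [wv] then forces [c' = c], because [c] is
   real and nonzero. *)
have vw x y : c' * w x y = c' * conjc (v y x).
  rewrite -[w x y]coefE Fv// munitE innerZl inner_deltal.
  by rewrite -[v y0 x0]coefE.
have wv x y : c * v y x = c * conjc (w x y).
  rewrite -[v y x]coefE Fw// munitE innerZl inner_deltal.
  by rewrite -[w x0 y0]coefE.
have cR : conjc c = c by rewrite (cE x0) /= oppr0.
have c'c : c' = c.
  have := wv x0 y0; rewrite -[v y0 x0]coefE -[w x0 y0]coefE -/c' -/c cR.
  by move=> /(mulfI c0).
have vwE x y : w x y = conjc (v y x) by have := vw x y; rewrite c'c => /(mulfI c0).
(* All [v y] and [w x] have the same norm, the square root of [c]; dividing by it gives unit vectors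
   and cancels the scalar in [Fv] and [Fw]. *)
pose r := l2norm (w x0).
have cr : c = (r ^+ 2)%:C%C by exact: cE.
have r0 : r != 0 by move: c0; rewrite cr; apply: contra_neq => ->; rewrite expr0n.
have rge : 0 <= r by exact: l2norm_ge0.
have rn : normc (r^-1)%:C%C = r^-1 by rewrite normc_real// invr_ge0.
have ww x : l2norm (w x) = r.
  apply/eqP; rewrite -(@eqrXn2 _ 2)// ?l2norm_ge0//; apply/eqP.
  by have := cE x; rewrite cr => -[].
have vv y : l2norm (v y) = r.
  apply/eqP; rewrite -(@eqrXn2 _ 2)// ?l2norm_ge0//; apply/eqP.
  by have := c'E y; rewrite c'c cr => -[].
have conjr : conjc (r^-1)%:C%C = (r^-1)%:C%C by rewrite /= oppr0.
have rr : (r^-1)%:C%C * (r^-1)%:C%C * c = 1.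
  by rewrite cr -!rmorphM /= -expr2 -exprMn mulVf// expr1n.
exists (fun y => (r^-1)%:C%C *: v y), (fun x => (r^-1)%:C%C *: w x); split.
- by move=> x y; rewrite !l2Z conjcM conjr vwE.
- by split=> [y|x]; rewrite l2normZ rn ?ww ?vv mulVf.
- move=> a y y' aX; rewrite bopZ innerZl innerZr -Fv// c'c.
  by rewrite conjr !mulrA rr mul1r.
- move=> b x x' bY; rewrite bopZ innerZl innerZr -Fw//.
  by rewrite conjr !mulrA rr mul1r.
Qed.

End spatial_kernel.

(** * Paving and transport of entourages *)

Section paving.
Context (R : realType).

(** Take a colouring minimizing the total weight [E] inside the classes. By symmetry, recolouring
    [t0] alone changes [E] by twice the change of its row sum, so the row sum of [t0] inside its own
    class is at most its row sum into any of the [m.+1] colours, and these add up to at most [K]. *)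
Lemma paving_fin (T : finType) (m : nat) (N : T -> T -> R) (K : R) :
  (forall t s, N t s = N s t) -> (forall t, N t t = 0) ->
  (forall t, \sum_s N t s <= K) ->
  exists c : T -> 'I_m.+1,
    forall t, m.+1%:R * (\sum_(s | c s == c t) N t s) <= K.
Proof.
move=> Nsym N0 NK.
pose E (c : {ffun T -> 'I_m.+1}) := \sum_t \sum_(s | c s == c t) N t s.
have Esplit c t0 : E c =
    2 * (\sum_(s | c s == c t0) N t0 s) +
    \sum_(t | t != t0) \sum_(s | (s != t0) && (c s == c t)) N t s.
  rewrite /E (bigD1 t0)//= mulr_natl mulr2n -addrA; congr (_ + _).
  have -> : \sum_(s | c s == c t0) N t0 s =
      \sum_(t | t != t0) (if c t == c t0 then N t0 t else 0).
    by rewrite big_mkcond (bigD1 t0)//= N0 if_same add0r.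
  rewrite -big_split /=.
  apply: eq_bigr => t tt0; rewrite eq_sym; case: ifPn => ct.
    by rewrite (bigD1 t0) //= Nsym; congr (_ + _); apply: eq_bigl => s; rewrite andbC.
  rewrite add0r; apply: eq_bigl => s; case: (eqVneq s t0) => [->|//].
  exact: negbTE.
pose c0 : {ffun T -> 'I_m.+1} := [ffun=> ord0].
have [c _ cmin] := @arg_minP _ R _ c0 xpredT E isT.
exists c => t0; apply: le_trans (NK t0).
suff h j : \sum_(s | c s == c t0) N t0 s <= \sum_(s | c s == j) N t0 s.
  rewrite [X in _ <= X](partition_big c xpredT)//=.
  rewrite -[X in X%:R](card_ord m.+1) mulr_natl -sumr_const.
  by apply: ler_sum => j _; exact: h.
pose c' : {ffun T -> 'I_m.+1} := [ffun t => if t == t0 then j else c t].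
have := cmin c' isT; rewrite (Esplit c t0) (Esplit c' t0).
rewrite [X in _ <= _ + X](_ : _ =
    \sum_(t | t != t0) \sum_(s | (s != t0) && (c s == c t)) N t s); last first.
  apply: eq_bigr => t /negbTE tt0; apply: eq_bigl => s; rewrite !ffunE tt0.
  by case: eqP.
rewrite lerD2r ler_pM2l// => /le_trans; apply; rewrite !ffunE eqxx.
rewrite big_mkcond [X in _ <= X]big_mkcond /=; apply: ler_sum => s _.
rewrite ffunE; case: (eqVneq s t0) => [->|//]; rewrite N0.
by rewrite !if_same.
Qed.

(* A colouring of a finite block minimizing the total weight inside the colour
   classes spreads every row evenly over the colours, and an ultrafilter on the
   finite blocks yields a colouring of the whole index set. *)
Lemma paving (I : choiceType) (M : I -> I -> R) (K e : R) :
  (forall t s, 0 <= M t s) -> 0 < e ->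
  (forall t (B : {fset I}), \sum_(s <- B) M t s <= K) ->
  (forall t (B : {fset I}), \sum_(s <- B) M s t <= K) ->
  exists (m : nat) (c : I -> 'I_m.+1), forall t (B : {fset I}),
    (forall s, s \in B -> s != t /\ c s = c t) -> \sum_(s <- B) M t s <= e.
Proof.
move=> M0 e0 rowK colK.
(* The factor 2 pays for symmetrizing: [N] below adds [M] to its transpose. *)
have [m hm] : exists m : nat, 2 * K <= m.+1%:R * e.
  exists (Num.truncn (2 * K / e)); rewrite -ler_pdivrMr//.
  exact/ltW/truncnS_gt.
exists m.
have fin (A : {fset I}) : exists c : I -> 'I_m.+1, forall t (B : {fset I}),
    t \in A -> (B `<=` A)%fset ->
    (forall s, s \in B -> s != t /\ c s = c t) -> \sum_(s <- B) M t s <= e.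
  pose N (t s : A) := if t == s then 0 else M (val t) (val s) + M (val s) (val t).
  have [||t|c hc] := @paving_fin A m N (2 * K).
  - move=> t s; rewrite /N eq_sym; case: ifP => // _; exact: addrC.
  - by move=> t; rewrite /N eqxx.
  - apply: (@le_trans _ _ (\sum_(s : A) (M (val t) (val s) + M (val s) (val t)))).
      by apply: ler_sum => s _; rewrite /N; case: ifP; rewrite ?addr_ge0.
    rewrite big_split mulr_natl mulr2n; apply: lerD.
      by rewrite -(big_seq_fsetE _ _ xpredT (fun s => M (val t) s)) /=.
    by rewrite -(big_seq_fsetE _ _ xpredT (fun s => M s (val t))) /=.
  pose d (s : I) := if insub s is Some s' then c s' else ord0.
  have dE (s : A) : d (val s) = c s by rewrite /d valK.
  exists d => t B tA BA hB.
  have {}hc := hc [` tA]%fset.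
  apply: (@le_trans _ _ (\sum_(s | c s == c [` tA]%fset) N [` tA]%fset s)); last first.
    rewrite -(@ler_pM2l _ m.+1%:R)//; exact: le_trans hc hm.
  pose G s := if (s != t) && (d s == d t) then M t s else 0.
  apply: (@le_trans _ _ (\sum_(s <- B) G s)).
    rewrite big_seq [X in _ <= X]big_seq; apply: ler_sum => s /hB[st cst].
    by rewrite /G st cst eqxx.
  apply: (@le_trans _ _ (\sum_(s <- A) G s)).
    by apply: ler_sum_fset => // s; rewrite /G; case: ifP.
  rewrite (big_seq_fsetE _ _ xpredT G) /= [X in _ <= X]big_mkcond; apply: ler_sum => s _.
  rewrite /N; have [<-|st] := eqVneq [` tA]%fset s.
    by rewrite /G /= eqxx /= if_same.
  have vst : val s != t by rewrite eq_sym; apply: contra_neq st => ts; exact: val_inj.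
  rewrite -(dE s) -(dE [` tA]%fset) /= /G vst /=.
  by case: ifP => // _; rewrite lerDl.
have [c hc] := choice fin.
have FF : ProperFilter (@summability.totally I).
  exact: summability.totally_filter.
have [G [UG tG]] := ultraFilterLemma FF.
(* There are finitely many colours, so exactly one of them is taken by [t] on a [G]-large set of
   blocks; it becomes the limit colour. *)
have col t : exists j, G [set A | c A t = j].
  apply: contrapT => /forallNP h.
  have hj j : \forall A \near G, ~ (c A t = j).
    by have [/h//|] := in_ultra_setVsetC [set A | c A t = j] UG.
  have [A hA] := filter_ex (filter_forall _ hj).
  exact: (hA (c A t)).
have [f hf] := choice col.
exists f => t B hB.
(* Only finitely many indices are tested, so one block contains them all and has a colouring that
   agrees with the limit on them. *)
pose C := (t |` B)%fset.
have GC : G (\bigcap_(s in [set` C]) [set A | c A s = f s]).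
  by apply: filter_bigI => // s _; exact: hf.
have GU : G [set A | (C `<=` A)%fset] by apply: tG; exists C.
have [A [/= cA CA]] := filter_ex (filterI GC GU).
have tC : t \in C by rewrite !inE eqxx.
have BC : (B `<=` C)%fset by apply/fsubsetP => s sB; rewrite !inE sB orbT.
apply: (hc A); first exact: (fsubsetP CA).
  exact: fsubset_trans CA.
move=> s sB; have [st fst] := hB s sB; split=> //.
by rewrite (cA s) ?(cA t)//=; exact: (fsubsetP BC).
Qed.

End paving.

(** * Uniform counting of fibres *)

Section finite_fibers.
Context (R : realType).

(** A cardinality bound witnessed by a list, possibly with repetitions; such bounds multiply easily
    along dependent pairs. *)
Definition covered (T : choiceType) (n : nat) (P : set T) :=
  exists L : seq T, (size L <= n)%N /\ forall t, P t -> t \in L.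

Lemma covered_sub (T : choiceType) n m (P Q : set T) :
  (n <= m)%N -> P `<=` Q -> covered n Q -> covered m P.
Proof.
move=> nm PQ [L [Ln LQ]]; exists L; split; first exact: leq_trans nm.
by move=> t /PQ/LQ.
Qed.

Lemma covered_pair (S T : choiceType) n m (P : set S) (Q : S -> set T) :
  covered n P -> (forall s, covered m (Q s)) ->
  covered (n * m) [set st | P st.1 /\ Q st.1 st.2].
Proof.
move=> [L [Ln LP]] /choice[K hK].
exists [seq (s, t) | s <- L, t <- K s]; split.
  rewrite size_allpairs_dep; apply: (@leq_trans (size L * m)); last first.
    by rewrite leq_mul2r Ln orbT.
  elim: L {Ln LP} => //= s L IH; rewrite mulSn leq_add//.
  by have [] := hK s.
move=> [s t] [/= /LP sL Qst]; apply/allpairsPdep; exists s, t; split=> //.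
by have [_ ->] := hK s.
Qed.

Lemma covered_inj (S T : choiceType) n (h : S -> T) (P : set S) (Q : set T) :
  injective h -> (forall s, P s -> Q (h s)) -> covered n Q -> covered n P.
Proof.
move=> hI PQ [L [Ln LQ]].
pose g (t : T) :=
  if pselect (exists s, h s = t) is left e then Some (projT1 (cid e)) else None.
have gh : pcancel h g.
  move=> s; rewrite /g; case: pselect => [e|]; last by case; exists s.
  by congr Some; apply: hI; exact: projT2 (cid e).
exists (pmap g L); split.
  by rewrite size_pmap; apply: leq_trans (count_size _ _) Ln.
move=> s /PQ/LQ hsL; rewrite mem_pmap -(gh s); exact: map_f.
Qed.

Lemma covered_card_le (T : choiceType) n (P : set T) :
  (P #<= `I_n)%card -> covered n P.
Proof.
move=> Pn; have finP : finite_set P by apply/finite_set_leP; exists n.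
exists (fset_set P); split; first exact: geq_card_fset_set.
by move=> t Pt; rewrite in_fset_set// mem_set.
Qed.

(** Chebyshev: each such coordinate uses up at least [d ^+ 2] of the unit mass. *)
Lemma covered_large_coord (X : choiceType) (u : l2 R X) (d : R) n :
  l2norm u = 1 -> 0 < d -> 1 < n.+1%:R * d ^+ 2 ->
  covered n [set x | d <= normc (u x)].
Proof.
move=> u1 d0 nd; set P := [set _ | _].
have small (A : {fset X}) : [set` A] `<=` P -> (#|` A| <= n)%N.
  move=> AP; rewrite -ltnS -(ltr_nat R); rewrite -(@ltr_pM2r _ (d ^+ 2)) ?exprn_gt0//.
  apply: le_lt_trans nd.
  apply: (@le_trans _ _ (\sum_(x <- A) normc (u x) ^+ 2)); last first.
    by apply: le_trans (sum_le_l2norm u A) _; rewrite u1 expr1n.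
  rewrite mulr_natl cardfE -sumr_const.
  rewrite [X in _ <= X](big_seq_fsetE _ _ xpredT (fun x => normc (u x) ^+ 2)) /=.
  apply: ler_sum => x _; rewrite lerXn2r ?nnegrE ?normc_ge0 ?(ltW d0)//.
  exact: (AP _ (valP x)).
have finP : finite_set P.
  apply: contrapT => infP; have [A AP] := infinite_set_fset n.+1 infP.
  by rewrite ltnNge small.
exists (fset_set P); split; first by apply: small; rewrite fset_setK.
by move=> t Pt; rewrite in_fset_set// mem_set.
Qed.

(** Grouping by the value of [h], each [f t] is counted at most [n] times. *)
Lemma sum_covered_fibers (I T : choiceType) n (h : I -> T) (f : T -> R) (B : {fset I}) :
  (forall t, covered n [set i | h i = t]) -> (forall t, 0 <= f t) ->
  (forall A : {fset T}, \sum_(t <- A) f t <= 1) ->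
  \sum_(i <- B) f (h i) <= n%:R.
Proof.
move=> cn f0 f1; rewrite (partition_big_imfset _ h) /=.
apply: (@le_trans _ _ (\sum_(t <- [fset h i | i in B]%fset) n%:R * f t)); last first.
  by rewrite -mulr_sumr ler_piMr.
apply: ler_sum => t _.
rewrite (eq_bigr (fun=> f t)); last by move=> i /eqP ->.
rewrite -big_filter big_const_seq count_predT iter_addr addr0 -[X in X <= _]mulr_natl.
rewrite ler_wpM2r// ler_nat; have [L [Ln hL]] := cn t.
apply: leq_trans Ln; apply: uniq_leq_size; first by rewrite filter_uniq.
by move=> i; rewrite mem_filter => /andP[/eqP/hL].
Qed.

End finite_fibers.

Section partial_injections.
Context (R : realType).

Lemma pmap_uniq_inj (S T : eqType) (g : S -> option T) (s : seq S) :
  (forall x y t, g x = Some t -> g y = Some t -> x = y) ->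
  uniq s -> uniq (pmap g s).
Proof.
move=> gI; elim: s => //= x s IH /andP[xs us].
case gx : (g x) => [t|] /=; last exact: IH.
rewrite IH// andbT mem_pmap; apply: contra xs => /mapP[y ys gy].
by rewrite (gI x y t).
Qed.

Lemma sum_pmap (S T : Type) (g : S -> option T) (f : T -> R) (s : seq S) :
  \sum_(x <- s) oapp f 0 (g x) = \sum_(t <- pmap g s) f t.
Proof.
elim: s => /= [|x s IH]; first by rewrite !big_nil.
by rewrite big_cons IH; case: (g x) => [t|] /=; rewrite ?big_cons ?add0r.
Qed.

Lemma sum_uniq_fset (T : choiceType) (s : seq T) (f : T -> R) :
  uniq s -> \sum_(t <- s) f t = \sum_(t <- [fset t in s]%fset) f t.
Proof.
by move=> us; apply: perm_big; apply: uniq_perm => // t; rewrite inE.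
Qed.

Context (Y : choiceType) (k : Y -> option Y).
Hypothesis kI : forall x y z, k x = Some z -> k y = Some z -> x = y.

(** Pullback along a partial injection, with default 0 where [k] is undefined. Injectivity makes it
    contractive; its matrix is the indicator of the graph of [k]. *)
Definition pshift (u : l2 R Y) (y : Y) : R[i] := oapp u 0 (k y).

Lemma pshift_sum_le (u : l2 R Y) (A : {fset Y}) :
  \sum_(y <- A) normc (pshift u y) ^+ 2 <= l2norm u ^+ 2.
Proof.
rewrite (eq_bigr (fun y => oapp (fun z => normc (u z) ^+ 2) 0 (k y))); last first.
  by move=> y _; rewrite /pshift; case: (k y) => [//|]; rewrite /oapp normc0 expr0n.
rewrite sum_pmap sum_uniq_fset ?sum_le_l2norm//.
exact: pmap_uniq_inj.
Qed.

Fact pshift_l2 (u : l2 R Y) : (pshift u : Y -> R[i]^o) \in @l2_pred R Y.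
Proof. by apply: l2_mem => A; exact: pshift_sum_le. Qed.

Fact partial_isometry_bop : (fun u => L2 (pshift_l2 u)) \in @bop_pred R (l2 R Y).
Proof.
apply/bop_predP; split=> [c u v|].
  apply: l2_ext => y; rewrite l2D l2Z /= /pshift.
  by case: (k y) => //=; rewrite mulr0 addr0.
exists 1 => u; rewrite mul1r !l2_normE lecR.
by apply: l2norm_le (l2norm_ge0 _) _ => A; exact: pshift_sum_le.
Qed.

Definition partial_isometry : bop (l2 R Y) := Bop partial_isometry_bop.

Lemma partial_isometryE u y : partial_isometry u y = oapp u 0 (k y).
Proof. by []. Qed.

Lemma coef_partial_isometry y z :
  coef partial_isometry y z = (k y == Some z)%:R.
Proof.
rewrite coefE partial_isometryE; case: (k y) => [w|]//=.
Qed.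

End partial_injections.

(** * Transport of entourages through the kernel *)

Section transport.
Context (R : realType) (X Y : choiceType).
Context (EX : coarseStructure X) (EY : coarseStructure Y).
Context (Psi : bop (l2 R Y) -> bop (l2 R X)) (xi : Y -> l2 R X) (eta : X -> l2 R Y).
Hypothesis ulfY : uniformly_locally_finite EY.
Hypothesis Psi_mem : forall b, uRoe EY b -> uRoe EX (Psi b).
Hypothesis etaE : forall x y, eta x y = conjc (xi y x).
Hypothesis xi1 : forall y, l2norm (xi y) = 1.
Hypothesis eta1 : forall x, l2norm (eta x) = 1.
Hypothesis Psi_coef : forall b x x', uRoe EY b ->
  coef (Psi b) x x' = inner (b (eta x')) (eta x).

Lemma entourages_bigcup (Z : Type) (EZ : coarseStructure Z) m (E : 'I_m -> set (Z * Z)) :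
  (forall j, entourages EZ (E j)) -> entourages EZ [set p | exists j, E j p].
Proof.
elim: m E => [|m IH] E hE.
  by apply: entourages_sub (entourages_diag EZ) => p [[]].
apply: entourages_sub (entourages_union (hE ord0) (IH _ (fun j => hE (lift ord0 j)))).
move=> p [j Ejp]; have [j0|[i ji]] : j = ord0 \/ exists i, j = lift ord0 i.
    by case: (unliftP ord0 j) => [i|] ->; [right; exists i|left].
  by left; rewrite -j0.
by right; exists i; rewrite -ji.
Qed.

Lemma normc_eta_xi x y : normc (eta x y) = normc (xi y x).
Proof. by rewrite etaE normcJ. Qed.

Lemma sum_indicator_le1 (T : choiceType) (z : T) (A : {fset T}) :
  \sum_(t <- A) (t == z)%:R <= 1 :> R.
Proof.
case: (boolP (z \in A)) => zA.
  rewrite (bigD1_seq z)//= eqxx big1 ?addr0// => t /negbTE ->.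
  by [].
by rewrite big_seq big1// => t tA; case: eqP => // tz; rewrite tz (negbTE zA) in tA.
Qed.

Lemma transport F d : entourages EY F -> 0 < d ->
  entourages EX [set xx | exists yy, [/\ F yy,
    d <= normc (eta xx.1 yy.1) & d <= normc (eta xx.2 yy.2)]].
Proof.
move=> FE d0; pose W x y := normc (eta x y).
have W0 x y : 0 <= W x y ^+ 2 by exact: sqr_ge0.
(* Adding the inverse bounds the rows and the columns of [F] by the same [n]. *)
have [n hn] := ulfY (entourages_union FE (entourages_inv FE)).
have covF y : covered n [set z | F (y, z)].
  by apply: covered_sub (covered_card_le (hn y)) => // z; left.
have covFV y : covered n [set z | F (z, y)].
  by apply: covered_sub (covered_card_le (hn y)) => // z; right.
have [k kd] : exists k : nat, 1 < k.+1%:R * d ^+ 2.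
  exists (Num.truncn (d ^+ 2)^-1); rewrite -ltr_pdivrMr ?exprn_gt0// mul1r.
  exact: truncnS_gt.
have covy x : covered k [set y | d <= W x y].
  exact: covered_large_coord (eta1 x) d0 kd.
have covx y : covered k [set x | d <= W x y].
  apply: covered_sub (covered_large_coord (xi1 y) d0 kd) => // x.
  by rewrite /W /= normc_eta_xi.
have cov1 (T : choiceType) (z : T) : covered 1 [set t | t = z].
  by exists [:: z]; split=> // t /= ->; rewrite mem_head.
pose D (t : (Y * Y) * (X * X)) :=
  [/\ F t.1, d <= W t.2.1 t.1.1 & d <= W t.2.2 t.1.2].
pose J := {t : (Y * Y) * (X * X) | `[< D t >]}.
have JD (s : J) : D (val s) by exact/asboolP/(valP s).
pose y1 (s : J) := (val s).1.1; pose y2 (s : J) := (val s).1.2.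
pose x1 (s : J) := (val s).2.1; pose x2 (s : J) := (val s).2.2.
have Jinj (s t : J) : y1 s = y1 t -> y2 s = y2 t -> x1 s = x1 t -> x2 s = x2 t -> s = t.
  rewrite /y1 /y2 /x1 /x2 => h1 h2 h3 h4; apply: val_inj; move: h1 h2 h3 h4.
  by case: (val s) => -[a b] [c f]; case: (val t) => -[a' b'] [c' f'] /= -> -> -> ->.
(* Once one of the four points of a configuration is fixed, the other three are reached by one step
   along [F] ([n] choices) and two steps along the relation [d <= W x y] ([k] choices each). *)
pose N := (n * k * k)%N.
have fy1 y : covered N [set s : J | y1 s = y].
  have cov := covered_pair (covered_pair (covered_pair (cov1 _ y) covF)
    (fun p => covx p.1)) (fun p => covx p.1.2).
  rewrite /N -[n]mul1n.
  apply: (covered_inj (h := fun s : J => (((y1 s, y2 s), x1 s), x2 s)) _ _ cov).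
    by move=> s t [*]; exact: Jinj.
  move=> s sy; have [Fs d1 d2] := JD s; do !split => //=.
  by rewrite /y1 /y2 -surjective_pairing.
have fy2 y : covered N [set s : J | y2 s = y].
  have cov := covered_pair (covered_pair (covered_pair (cov1 _ y) covFV)
    (fun p => covx p.2)) (fun p => covx p.1.1).
  rewrite /N -[n]mul1n.
  apply: (covered_inj (h := fun s : J => (((y2 s, y1 s), x1 s), x2 s)) _ _ cov).
    by move=> s t [*]; exact: Jinj.
  move=> s sy; have [Fs d1 d2] := JD s; do !split => //=.
  by rewrite /y1 /y2 -surjective_pairing.
have fx1 x : covered N [set s : J | x1 s = x].
  have cov := covered_pair (covered_pair (covered_pair (cov1 _ x) covy)
    (fun p => covF p.2)) (fun p => covx p.2).
  rewrite /N (mulnC n) -[k in (k * n * _)%N]mul1n.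
  apply: (covered_inj (h := fun s : J => (((x1 s, y1 s), y2 s), x2 s)) _ _ cov).
    by move=> s t [*]; exact: Jinj.
  move=> s sy; have [Fs d1 d2] := JD s; do !split => //=.
  by rewrite /y1 /y2 -surjective_pairing.
have fx2 x : covered N [set s : J | x2 s = x].
  have cov := covered_pair (covered_pair (covered_pair (cov1 _ x) covy)
    (fun p => covFV p.2)) (fun p => covx p.2).
  rewrite /N (mulnC n) -[k in (k * n * _)%N]mul1n.
  apply: (covered_inj (h := fun s : J => (((x2 s, y2 s), y1 s), x1 s)) _ _ cov).
    by move=> s t [*]; exact: Jinj.
  move=> s sy; have [Fs d1 d2] := JD s; do !split => //=.
  by rewrite /y1 /y2 -surjective_pairing.
(* The squares dominate the cross terms between [t] and [s]. The indicators make configurations that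
   share [y1] or [y2] interact with weight at least 1. *)
pose M (t s : J) : R := (W (x1 t) (y1 s) ^+ 2 + W (x2 t) (y2 s) ^+ 2) +
  ((y1 s == y1 t)%:R + (y2 s == y2 t)%:R).
(* The bound [d ^+ 2] controls the cross terms; the bound [2^-1], being below 1, keeps
   configurations that share [y1] or [y2] in different classes. *)
pose e := Num.min (d ^+ 2) (2^-1).
have e0 : 0 < e by rewrite lt_min exprn_gt0//= invr_gt0.
have Wy x (A : {fset Y}) : \sum_(y <- A) W x y ^+ 2 <= 1.
  by apply: le_trans (sum_le_l2norm (eta x) A) _; rewrite eta1 expr1n.
have Wx y (A : {fset X}) : \sum_(x <- A) W x y ^+ 2 <= 1.
  under eq_bigr do rewrite /W normc_eta_xi.
  by apply: le_trans (sum_le_l2norm (xi y) A) _; rewrite xi1 expr1n.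
have [|||m [c hc]] := @paving R J M (N%:R + N%:R + (N%:R + N%:R)) e _ e0.
- by move=> t s; rewrite !addr_ge0.
- move=> t B; rewrite !big_split /=; apply: lerD; apply: lerD.
  + exact: (@sum_covered_fibers R J Y N y1 (fun y => W (x1 t) y ^+ 2)).
  + exact: (@sum_covered_fibers R J Y N y2 (fun y => W (x2 t) y ^+ 2)).
  + apply: (@sum_covered_fibers R J Y N y1 (fun y => (y == y1 t)%:R)) => //.
    exact: sum_indicator_le1.
  + apply: (@sum_covered_fibers R J Y N y2 (fun y => (y == y2 t)%:R)) => //.
    exact: sum_indicator_le1.
- move=> t B; rewrite !big_split /=; apply: lerD; apply: lerD.
  + exact: (@sum_covered_fibers R J X N x1 (fun x => W x (y1 t) ^+ 2)).
  + exact: (@sum_covered_fibers R J X N x2 (fun x => W x (y2 t) ^+ 2)).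
  + apply: (@sum_covered_fibers R J Y N y1 (fun y => (y1 t == y)%:R)) => //.
    by move=> A; under eq_bigr do rewrite eq_sym; exact: sum_indicator_le1.
  + apply: (@sum_covered_fibers R J Y N y2 (fun y => (y2 t == y)%:R)) => //.
    by move=> A; under eq_bigr do rewrite eq_sym; exact: sum_indicator_le1.
have sep (s t : J) : c s = c t -> y1 s = y1 t \/ y2 s = y2 t -> s = t.
  move=> cst hy; apply: contrapT => /eqP st.
  have := hc t [fset s]%fset; rewrite big_seq_fset1 => /(_ _)/le_trans h.
  have : M t s <= 2^-1.
    apply: h; last by rewrite ge_min lexx orbT.
    by move=> s'; rewrite inE => /eqP ->.
  apply/negP; rewrite -ltNge; apply: (@lt_le_trans _ _ 1).
    by rewrite invf_lt1// ltr1n.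
  case: hy => hy; rewrite /M hy eqxx.
    by rewrite addrCA lerDl !addr_ge0.
  by rewrite addrA lerDr !addr_ge0.
(* By [sep] a configuration of colour [j] is determined by its first point, and also by its second,
   so each colour class is the graph of a partial injection [kap j] inside [F]. *)
pose sig j y : option J :=
  if pselect (exists s, c s = j /\ y1 s = y) is left h then Some (projT1 (cid h)) else None.
have sigP j y s : sig j y = Some s -> c s = j /\ y1 s = y.
  rewrite /sig; case: pselect => // h [<-]; exact: projT2 (cid h).
have sigE s : sig (c s) (y1 s) = Some s.
  case h : (sig (c s) (y1 s)) => [t|].
    by have [ct yt] := sigP _ _ _ h; congr Some; apply: sep => //; left.
  by move: h; rewrite /sig; case: pselect => // -[]; exists s.
pose kap j y := omap y2 (sig j y).
have kapI j : forall y y' z, kap j y = Some z -> kap j y' = Some z -> y = y'.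
  move=> y y' z; rewrite /kap; case h : (sig j y) => [s|]//= [sz].
  case h' : (sig j y') => [s'|]//= [s'z].
  have [cs <-] := sigP _ _ _ h; have [cs' <-] := sigP _ _ _ h'.
  by congr y1; apply: sep; [rewrite cs cs'|right; rewrite sz s'z].
pose b j := partial_isometry R (@kapI j).
have bE j : uRoe EY (b j).
  apply: uRoe_fin; apply: entourages_sub FE => -[y z] /suppP.
  rewrite coef_partial_isometry; case: (kap j y =P Some z) => [|_]; last by rewrite eqxx.
  rewrite /kap; case h : (sig j y) => [s|]//= [<-] _.
  by have [_ <-] := sigP _ _ _ h; have [+ _ _] := JD s; rewrite -surjective_pairing.
have d20 : 0 < d ^+ 2 / 2 by rewrite divr_gt0// exprn_gt0.
apply: entourages_sub (entourages_bigcup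
  (fun j => entourages_coef_ge (Psi_mem (bE j)) d20)).
move=> [x x'] [[y y'] [Fyy dxy dxy']].
have Dt : D ((y, y'), (x, x')) by [].
pose t : J := @exist _ (fun t => `[< D t >]) ((y, y'), (x, x')) (asboolT Dt).
exists (c t) => /=; rewrite Psi_coef//.
have tE : [/\ y1 t = y, y2 t = y', x1 t = x & x2 t = x'] by [].
have main : normc (b (c t) (eta x') y * conjc (eta x y)) >= d ^+ 2.
  rewrite partial_isometryE /kap -[y]/(y1 t) sigE /= normcM normcJ expr2.
  by apply: ler_pM => //; exact: ltW.
(* The main term, at [y], comes from [t] itself. Every other term comes from some [s] of the same
   colour and is at most [M t s / 2] by the arithmetic-geometric mean inequality. *)
have : normc (inner (b (c t) (eta x')) (eta x) -
    b (c t) (eta x') y * conjc (eta x y)) <= d ^+ 2 / 2.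
  apply: inner_near => A yA.
  apply: (@le_trans _ _ (\sum_(z <- A) oapp (fun s => 2^-1 * M t s) 0 (sig (c t) z))).
    rewrite big_seq [X in _ <= X]big_seq; apply: ler_sum => z zA.
    rewrite partial_isometryE /kap; case h : (sig (c t) z) => [s|]; last first.
      by rewrite [oapp _ _ _]/= normc0 mul0r.
    have [_ <-] := sigP _ _ _ h; rewrite /= -/(W x' (y2 s)) -/(W x (y1 s)).
    apply: (@le_trans _ _ (2^-1 * (W x (y1 s) ^+ 2 + W x' (y2 s) ^+ 2))); last first.
      by rewrite ler_pM2l ?invr_gt0// lerDl addr_ge0.
    rewrite ler_pdivlMl// -subr_ge0.
    rewrite (_ : _ - _ = (W x (y1 s) - W x' (y2 s)) ^+ 2) ?sqr_ge0//; ring.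
  rewrite sum_pmap -mulr_sumr mulrC ler_pM2r ?invr_gt0//.
  have inj : forall z z' s, sig (c t) z = Some s -> sig (c t) z' = Some s -> z = z'.
    by move=> z z' s /sigP[_ <-] /sigP[_ <-].
  rewrite sum_uniq_fset; last exact: pmap_uniq_inj.
  apply: le_trans (hc t _ _) _; last by rewrite ge_min lexx.
  move=> s; rewrite inE /= mem_pmap => /mapP[z zA /esym sz].
  have [cs ys] := sigP _ _ _ sz; split=> //.
  by apply: contraNneq yA => st; rewrite -[y]/(y1 t) -st ys.
move: main; set p := inner _ _; set q := _ * _ => main pq.
have qE : q = p - (p - q) by rewrite opprB addrC subrK.
have : d ^+ 2 <= normc p + d ^+ 2 / 2.
  apply: le_trans main _; rewrite qE; apply: le_trans (normcD_le _ _) _.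
  by rewrite normcN lerD2l.
by rewrite {1}(splitr (d ^+ 2)) lerD2r.
Qed.

End transport.

(** * Existence of large coordinates: metrizability *)

Section gliding_hump.
Context (R : realType) (S : Type) (T : choiceType) (v : S -> l2 R T).

(** Recursive choice: a vector flat enough to have little mass on the finite set [P] of coordinates
    already used, followed by a finite set that carries most of it, from which [P] is removed. *)
Lemma gliding_hump (tau : nat -> R) : (forall n, 0 < tau n) ->
  (forall d : R, 0 < d -> exists s, forall t, normc (v s t) <= d) ->
  exists (s : nat -> S) (B : nat -> {fset T}),
    [/\ forall n t, normc (v (s n) t) <= tau n,
        forall n, l2norm (v (s n) - restrict_fun [set` B n] (v (s n))) <= tau n &
        forall m n t, t \in B m -> t \in B n -> m = n].
Proof.
move=> tau0 small.
have step (np : nat * {fset T}) : exists sB : S * {fset T},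
    [/\ forall t, normc (v sB.1 t) <= tau np.1,
        l2norm (v sB.1 - restrict_fun [set` sB.2] (v sB.1)) <= tau np.1 &
        forall t, t \in sB.2 -> t \notin np.2].
  case: np => n P /=; set p := (#|` P|)%:R : R.
  have p0 : 0 < p + 1 by rewrite ltr_wpDl// ler0n.
  (* Over the [p] coordinates of [P] this adds up to at most [tau n / 2]; the other half of [tau n]
     is for the truncation to [A]. *)
  have [|s hs] := small (tau n / 2 / (p + 1)); first by rewrite !divr_gt0.
  have [|A /ltW hA] := @l2_dense R T (v s) (tau n / 2); first by rewrite divr_gt0.
  exists (s, (A `\` P)%fset); split=> /= [t||t]; last by rewrite inE => /andP[].
    apply: le_trans (hs t) _; rewrite -mulrA ler_piMr ?(ltW (tau0 n))//.
    rewrite -invfM invf_le1 ?mulr_gt0//.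
    have : 0 <= p by exact: ler0n.
    by move=> ?; lra.
  have -> : v s - restrict_fun [set` (A `\` P)%fset] (v s) =
      (v s - restrict_fun [set` A] (v s)) + restrict_fun [set` (A `&` P)%fset] (v s).
    rewrite -addrA; congr (_ + _); apply: l2_ext => t.
    rewrite l2D !l2N !restrict_funE !mem_setE !inE.
    by case: (t \in A); case: (t \in P); rewrite /= ?oppr0 ?addr0 ?addNr.
  rewrite [X in _ <= X]splitr; apply: le_trans (l2normD _ _) _; apply: lerD => //.
  rewrite restrict_fset_sum; apply: le_trans (l2norm_sum _ _ _) _.
  apply: (@le_trans _ _ (\sum_(x <- P) normc (v s x))).
    apply: le_trans (_ : \sum_(x <- (A `&` P)%fset) normc (v s x) <= _).
      by apply: ler_sum => x _; rewrite l2normZ l2norm_delta mulr1.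
    by apply: ler_sum_fset; [move=> x; exact: normc_ge0|exact: fsubsetIr].
  apply: (@le_trans _ _ (\sum_(x <- P) tau n / 2 / (p + 1))).
    by apply: ler_sum => x _; exact: hs.
  rewrite big_const_seq count_predT iter_addr addr0 -[X in X <= _]mulr_natl -/p mulrCA.
  rewrite ler_piMr ?divr_ge0 ?(ltW (tau0 n))// ler_pdivrMr// mul1r lerDl//.
have [g hg] := choice step.
pose P := fix P n := if n is m.+1 then (P m `|` (g (m, P m)).2)%fset else fset0.
pose B n := (g (n, P n)).2.
have BP m n t : (m < n)%N -> t \in B m -> t \in P n.
  elim: n => // n IH; rewrite ltnS leq_eqVlt => /orP[/eqP ->|mn] tB /=.
    by rewrite inE tB orbT.
  by rewrite inE IH.
exists (fun n => (g (n, P n)).1), B; split.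
- by move=> n t; have [h _ _] := hg (n, P n); exact: h.
- by move=> n; have [_ h _] := hg (n, P n); exact: h.
- move=> m n t tm tn; have notP k : t \in B k -> t \notin P k.
    by have [_ _ h] := hg (k, P k); exact: h.
  case: (ltngtP m n) => // mn.
    by have := notP _ tn; rewrite (BP m).
  by have := notP _ tm; rewrite (BP n).
Qed.

End gliding_hump.

Section balancing_signs.
Context (R : realType).

Lemma parallelogram (a c : R[i]) :
  normc (a + c) ^+ 2 + normc (a - c) ^+ 2 = 2 * normc a ^+ 2 + 2 * normc c ^+ 2.
Proof.
case: a c => [a b] [c d] /=.
by rewrite !sqr_sqrtr ?addr_ge0 ?sqr_ge0//; ring.
Qed.

(** Signs are chosen one at a time: by the parallelogram law the two choices for a new vector
    average to the sum of the squared norms, so one of them does not exceed it. *)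
Lemma balancing_signs (T X : choiceType) (c : T -> X -> R[i]) (K : seq X) (B : seq T) :
  uniq B -> exists sg : T -> bool,
  \sum_(x <- K) normc (\sum_(y <- B) (-1) ^+ sg y * c y x) ^+ 2 <=
  \sum_(y <- B) \sum_(x <- K) normc (c y x) ^+ 2.
Proof.
elim: B => [_|y B IH /= /andP[yB /IH[sg hsg]]].
  by exists (fun=> false); rewrite big_nil big1// => x _; rewrite big_nil normc0 expr0n.
pose a x := \sum_(z <- B) (-1) ^+ sg z * c z x.
pose Q (e : bool) := \sum_(x <- K) normc ((-1) ^+ e * c y x + a x) ^+ 2.
have QE : Q false + Q true = 2 * \sum_(x <- K) normc (a x) ^+ 2 +
    2 * \sum_(x <- K) normc (c y x) ^+ 2.
  rewrite /Q -big_split /= !mulr_sumr -big_split /=; apply: eq_bigr => x _.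
  rewrite expr0 expr1 mul1r mulN1r ![_ + a x]addrC; exact: parallelogram.
have [e he] : exists e, Q e <= \sum_(x <- K) normc (c y x) ^+ 2 +
    \sum_(x <- K) normc (a x) ^+ 2.
  set u := \sum_(x <- K) _ in QE *; set w := \sum_(x <- K) _ in QE *.
  have [h|h] := lerP (Q false) (w + u); first by exists false.
  exists true; lra.
exists (fun z => if z == y then e else sg z); rewrite big_cons.
apply: le_trans (_ : _ <= \sum_(x <- K) normc (c y x) ^+ 2 +
    \sum_(x <- K) normc (a x) ^+ 2) _; last by rewrite lerD2l.
apply: le_trans he; rewrite le_eqVlt; apply/orP; left; apply/eqP.
apply: eq_bigr => x _; rewrite big_cons eqxx; congr (normc (_ + _) ^+ 2).
apply: eq_big_seq => z zB; case: eqP => // zy.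
by rewrite -zy zB in yB.
Qed.

End balancing_signs.

Section sign_operators.
Context (R : realType) (Y : choiceType) (sg : Y -> bool).

Definition sign_op : bop (l2 R Y) :=
  chi R [set y | ~~ sg y] - chi R [set y | sg y].

Lemma sign_opE u y : sign_op u y = (-1) ^+ sg y * u y.
Proof.
rewrite /sign_op bopE_B l2B.
have -> A (w : l2 R Y) : chi R A w = restrict_fun A w by [].
have -> : restrict_fun [set z | ~~ sg z] u y = if sg y then 0 else u y.
  rewrite restrict_funE; case sy : (sg y); last by rewrite mem_set//= sy.
  by rewrite memNset//= sy.
have -> : restrict_fun [set z | sg z] u y = if sg y then u y else 0.
  rewrite restrict_funE; case sy : (sg y); first by rewrite mem_set.
  by rewrite memNset//= sy.
by case: (sg y); rewrite /= ?sub0r ?subr0 ?expr1 ?expr0 ?mul1r ?mulN1r.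
Qed.

Lemma sign_op_delta y : sign_op (delta R y) = (-1) ^+ sg y *: delta R y.
Proof.
apply: l2_ext => z; rewrite sign_opE l2Z deltaE.
by case: eqP => [->//|_]; rewrite !mulr0.
Qed.

Lemma sign_op_sqr : sign_op * sign_op = 1.
Proof.
apply: bop_ext => u; apply: l2_ext => y; rewrite bopE_M !sign_opE bopE_1.
by rewrite mulrA -expr2 sqrr_sign mul1r.
Qed.

Lemma sign_op_adjoint : adjoint_of sign_op sign_op.
Proof.
move=> u w; apply: inner_ext => y; rewrite !sign_opE conjcM -!mulrA mulrCA.
congr (_ * (_ * _)); case: (sg y); rewrite ?expr0 ?expr1 ?conjcN;
  by rewrite (rmorph1 (@conjc R)).
Qed.

Lemma l2norm_sign_op u : l2norm (sign_op u) <= l2norm u.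
Proof.
apply: l2norm_le (l2norm_ge0 _) _ => A; apply: le_trans (sum_le_l2norm u A).
apply: ler_sum => y _; rewrite sign_opE normcM.
case: (sg y); rewrite ?expr1 ?expr0 ?normcN normc1 mul1r//.
Qed.

Lemma uRoe_sign_op (EY : coarseStructure Y) : uRoe EY sign_op.
Proof. by apply: uRoeB; exact: chi_uRoe. Qed.

End sign_operators.

Section large_coordinates.
Context (R : realType) (X Y : choiceType).
Context (EX : coarseStructure X) (EY : coarseStructure Y).
Context (Psi : bop (l2 R Y) -> bop (l2 R X)) (eta : X -> l2 R Y).
Hypothesis ulfX : uniformly_locally_finite EX.
Hypothesis isoPsi : star_isomorphism EY EX Psi.
Hypothesis eta1 : forall x, l2norm (eta x) = 1.
Hypothesis Psi_coef : forall b x x', uRoe EY b ->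
  coef (Psi b) x x' = inner (b (eta x')) (eta x).

(* If the vectors [eta x] had no large coordinates, a gliding hump and balanced
   signs would give a symmetry in C*_u(Y) whose image moves almost all the mass of
   [delta x_n] off the [E n]-neighbourhood of [x_n]. *)
Lemma large_coordinates (E : nat -> set (X * X)) :
  (forall n, entourages EX (E n)) ->
  (forall F, entourages EX F -> exists n, F `<=` E n) ->
  exists2 d : R, 0 < d & forall x, exists y, d < normc (eta x y).
Proof.
move=> EE Ecof; apply: contrapT => nlarge.
have small (d : R) : 0 < d -> exists x, forall y, normc (eta x y) <= d.
  move=> d0; apply: contrapT => h; apply: nlarge; exists d => // x.
  apply: contrapT => /forallNP hx; apply: h; exists x => y.
  by rewrite leNgt; apply/negP/hx.
have /choice[N hN] n : exists N, forall x, covered N [set x' | E n (x', x)].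
  have [N hN] := ulfX (entourages_inv (EE n)).
  by exists N => x; exact: (covered_card_le (hN x)).
(* Chosen so that [4 * (N n + 1) * tau n ^+ 2 = tau n / 2], which is at most [4^-1 ^+ 2]. *)
pose tau n : R := (8 * ((N n)%:R + 1))^-1.
have N1 n : 0 < (N n)%:R + 1 :> R by rewrite ltr_wpDl// ler0n.
have tau0 n : 0 < tau n by rewrite invr_gt0 mulr_gt0.
have [s [B [Bsmall Bclose Bdisj]]] := gliding_hump tau0 small.
have /choice[K hK] n : exists K : {fset X},
    (#|` K| <= N n)%N /\ forall x', E n (x', s n) -> x' \in K.
  have [L [Ln LE]] := hN n (s n); exists [fset x in L]%fset; split.
    rewrite card_fseq; apply: leq_trans Ln; exact: size_undup.
  by move=> x' /LE; rewrite inE.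
pose c n y x' := eta (s n) y * conjc (eta x' y).
have /choice[sg hsg] n : exists sg : Y -> bool,
    \sum_(x' <- K n) normc (\sum_(y <- B n) (-1) ^+ sg y * c n y x') ^+ 2 <=
    \sum_(y <- B n) \sum_(x' <- K n) normc (c n y x') ^+ 2.
  exact: balancing_signs.
(* The sign patterns glue because the sets [B n] are disjoint; outside their union the sign is
   +1. *)
pose sigma y := if pselect (exists n, y \in B n) is left h
  then sg (projT1 (cid h)) y else false.
have sigmaE n y : y \in B n -> sigma y = sg n y.
  move=> yB; rewrite /sigma; case: pselect => [h|[]]; last by exists n.
  by rewrite (Bdisj _ _ _ (projT2 (cid h)) yB).
pose b := sign_op R sigma.
have bY : uRoe EY b by exact: uRoe_sign_op.
pose u := Psi b.
have uu : u * u = 1 by rewrite -(isoM isoPsi)// sign_op_sqr (iso1 isoPsi).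
have us : adjoint_of u u.
  by apply: (iso_adjoint isoPsi) => //; exact: sign_op_adjoint.
have u1 x : l2norm (u (delta R x)) = 1.
  have : inner (u (delta R x)) (u (delta R x)) = 1.
    by rewrite us -bopE_M uu bopE_1 inner_delta deltaE eqxx.
  rewrite inner_self => -[h].
  by apply/eqP; rewrite -(@eqrXn2 _ 2)// ?l2norm_ge0// h expr1n.
have uX : uRoe EX u by exact: iso_mem isoPsi _ bY.
have [|a aE ua] := (uRoeP _ _).1 uX (2^-1); first by rewrite invr_gt0.
(* The support of the approximant [a] lies in some [E n], so column [s n] of [a] lives on [K n],
   exactly where the signs made column [s n] of [u] small. *)
have [n an] := Ecof _ aE.
set x := s n; set w := u (delta R x).
(* Split [eta x] into its part on [B n], where the signs are balanced, and a tail of norm at most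
   [tau n]. *)
have col x' : normc (coef u x' x) ^+ 2 <=
    2 * normc (\sum_(y <- B n) (-1) ^+ sg n y * c n y x') ^+ 2 + 2 * tau n ^+ 2.
  rewrite Psi_coef//.
  rewrite -{1}(subrK (restrict_fun [set` B n] (eta x)) (eta x)) addrC bopD innerDl.
  apply: le_trans (normc_sqrD2 _ _) _; apply: lerD.
    rewrite le_eqVlt; apply/orP; left; apply/eqP; congr (2 * normc _ ^+ 2).
    rewrite restrict_fset_sum bop_sum inner_suml; apply: eq_big_seq => y yB.
    by rewrite bopZ sign_op_delta !innerZl inner_deltal (sigmaE n)// mulrCA.
  rewrite ler_pM2l// lerXn2r ?nnegrE ?normc_ge0 ?(ltW (tau0 n))//.
  apply: le_trans (cauchy_schwarz _ _) _; rewrite eta1 mulr1.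
  by apply: le_trans (l2norm_sign_op _ _) _; exact: Bclose.
have mass : \sum_(x' <- K n) normc (coef u x' x) ^+ 2 <= 4^-1 ^+ 2.
  apply: (@le_trans _ _ (\sum_(x' <- K n) (2 * normc (\sum_(y <- B n)
     (-1) ^+ sg n y * c n y x') ^+ 2 + 2 * tau n ^+ 2))).
    by apply: ler_sum => x' _; exact: col.
  have Kn : (size (K n))%:R <= (N n)%:R + 1 :> R.
    by apply: (@le_trans _ _ (N n)%:R); rewrite ?lerDl// ler_nat; have [] := hK n.
  apply: (@le_trans _ _ (4 * ((size (K n))%:R * tau n ^+ 2))).
    rewrite big_split /= -mulr_sumr big_const_seq count_predT iter_addr addr0.
    rewrite -[X in _ + X]mulr_natl.
    have -> : 4 * ((size (K n))%:R * tau n ^+ 2) =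
      2 * ((size (K n))%:R * tau n ^+ 2) + (size (K n))%:R * (2 * tau n ^+ 2) by ring.
    rewrite lerD2r ler_pM2l//; apply: le_trans (hsg n) _.
    rewrite exchange_big /= -sum1_size natr_sum mulr_suml; apply: ler_sum => x' _.
    rewrite mul1r.
    apply: (@le_trans _ _ (\sum_(y <- B n) tau n ^+ 2 * normc (eta x' y) ^+ 2)).
      apply: ler_sum => y _; rewrite normcM normcJ exprMn ler_wpM2r ?sqr_ge0//.
      by rewrite lerXn2r ?nnegrE ?normc_ge0 ?(ltW (tau0 n)).
    rewrite -mulr_sumr ler_piMr ?sqr_ge0//.
    by apply: le_trans (sum_le_l2norm (eta x') (B n)) _; rewrite eta1 expr1n.
  apply: (@le_trans _ _ (4 * (((N n)%:R + 1) * tau n ^+ 2))).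
    by rewrite ler_pM2l// ler_wpM2r ?sqr_ge0.
  have -> : 4 * (((N n)%:R + 1) * tau n ^+ 2) = tau n * 2^-1.
    by rewrite /tau; field; rewrite gt_eqF.
  apply: (@le_trans _ _ (8^-1 * 2^-1)); last first.
    by rewrite le_eqVlt; apply/orP; left; apply/eqP; field.
  rewrite ler_pM2r ?invr_gt0// /tau invfM ler_piMr ?invr_ge0//.
  by rewrite invf_le1// lerDr ler0n.
have near_part : l2norm (restrict_fun [set` K n] w) <= 4^-1.
  apply: l2norm_le => [|A]; first by rewrite invr_ge0.
  apply: le_trans mass.
  have -> : \sum_(x' <- K n) normc (coef u x' x) ^+ 2 =
      \sum_(x' <- K n) normc (restrict_fun [set` K n] w x') ^+ 2.
    apply: eq_big_seq => x' xK.
    by rewrite coefE restrict_funE mem_setE xK.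
  apply: le_trans (_ : \sum_(x' <- (A `|` K n)%fset)
      normc (restrict_fun [set` K n] w x') ^+ 2 <= _).
    by apply: ler_sum_fset => [?|]; rewrite ?sqr_ge0// fsubsetUl.
  rewrite (bigID (mem (K n))) /= [X in _ + X]big1 ?addr0; last first.
    by move=> x' xK; rewrite mem_setE (negbTE xK) normc0 expr0n.
  rewrite -big_filter le_eqVlt; apply/orP; left; apply/eqP.
  apply: perm_big; apply: uniq_perm; rewrite ?filter_uniq ?fset_uniq// => x'.
  by rewrite mem_filter in_fsetU; case: (x' \in K n); rewrite ?orbT.
have far_part : l2norm (w - restrict_fun [set` K n] w) <= 2^-1.
  rewrite restrict_setC.
  have -> : restrict_fun (~` [set` K n]) w =
      restrict_fun (~` [set` K n]) ((u - a) (delta R x)).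
    apply: l2_ext => x'; rewrite !restrict_funE in_setC mem_setE.
    case: (boolP (x' \in K n)) => [//|xK].
    change (w x' = (u - a) (delta R x) x'); rewrite bopE_B l2B -[a (delta R x) x']coefE.
    have [->|h] := eqVneq (coef a x' x) 0; first by rewrite subr0.
    by have [_ /(_ x')] := hK n; rewrite (negbTE xK) => /(_ (an (x', x) h)).
  apply: le_trans (l2norm_restrict_le _ _) _.
  by apply: le_trans (l2norm_bop_le _ _) _; rewrite l2norm_delta mulr1.
(* The unit vector [w] would have norm at most [2^-1 + 4^-1]. *)
have := l2normD (w - restrict_fun [set` K n] w) (restrict_fun [set` K n] w).
rewrite subrK u1 => h.
have : 1 <= 2^-1 + 4^-1 :> R by apply: le_trans h _; exact: lerD.
lra.
Qed.

End large_coordinates.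

(** * Existence of large coordinates: block-rank-one ghosts *)

Section rank_one_projections.
Context (R : realType) (X : choiceType).
Implicit Types (u v w : l2 R X) (p : bop (l2 R X)).

Lemma l2norm_mono u v : (forall x, normc (u x) <= normc (v x)) -> l2norm u <= l2norm v.
Proof.
move=> uv; apply: l2norm_le (l2norm_ge0 _) _ => A.
apply: le_trans (sum_le_l2norm v A); apply: ler_sum => x _.
by rewrite lerXn2r ?nnegrE ?normc_ge0.
Qed.

Lemma rank1_mul u v u' v' : rank1 u v * rank1 u' v' = inner u' v *: rank1 u v'.
Proof.
by apply: bop_ext => w; rewrite bopE_M bopE_Z !rank1E innerZl scalerA mulrC.
Qed.

Lemma adjoint_rank1 u v : adjoint_of (rank1 u v) (rank1 v u).
Proof.
by apply: adjoint_ofP => x z; rewrite !coef_rank1 conjcM conjcK mulrC.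
Qed.

Lemma projection_contractive p u : is_projection p -> l2norm (p u) <= l2norm u.
Proof.
move=> [pp ps]; have [->|pn0] := eqVneq (l2norm (p u)) 0; first exact: l2norm_ge0.
have pgt0 : 0 < l2norm (p u) by rewrite lt_neqAle eq_sym pn0 l2norm_ge0.
rewrite -(ler_pM2r pgt0) -expr2.
have := cauchy_schwarz u (p u).
have -> : inner u (p u) = inner (p u) (p u) by rewrite ps -bopE_M pp.
by rewrite inner_self normc_real// sqr_ge0.
Qed.

Lemma rank1_dist u v : l2norm u = 1 -> l2norm v = 1 ->
  opnorm (rank1 u u - rank1 v v) <= 2 * l2norm (u - v).
Proof.
move=> u1 v1; apply: opnorm_le_l2 => [|w]; first by rewrite mulr_ge0 ?l2norm_ge0.
rewrite bopE_B !rank1E.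
have -> : inner w u *: u - inner w v *: v = inner w (u - v) *: u + inner w v *: (u - v).
  by rewrite innerBr scalerBl scalerBr addrA subrK.
apply: le_trans (l2normD _ _) _; rewrite !l2normZ u1 mulr1 -mulrA mulr_natl mulr2n.
apply: lerD.
  by apply: le_trans (cauchy_schwarz _ _) _; rewrite mulrC.
rewrite mulrC ler_wpM2l ?l2norm_ge0//.
by apply: le_trans (cauchy_schwarz _ _) _; rewrite v1 mulr1.
Qed.

End rank_one_projections.

(** * Infinite sums of rank-one projections on disjoint finite blocks *)

Section block_projections.
Context (R : realType) (X : choiceType).
Context (F : nat -> {fset X}) (zeta : nat -> l2 R X).
Hypothesis Fdisj : forall m n x, x \in F m -> x \in F n -> m = n.
Hypothesis zeta_supp : forall n x, x \notin F n -> zeta n x = 0.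
Hypothesis zeta1 : forall n, l2norm (zeta n) = 1.

Let theta n := rank1 (zeta n) (zeta n).

Definition block_index (x : X) : option nat :=
  if pselect (exists n, x \in F n) is left h then Some (projT1 (cid h)) else None.

Lemma block_indexE x n : x \in F n -> block_index x = Some n.
Proof.
move=> xF; rewrite /block_index; case: pselect => [h|[]]; last by exists n.
by rewrite (Fdisj (projT2 (cid h)) xF).
Qed.

Lemma block_indexP x n : block_index x = Some n -> x \in F n.
Proof. by rewrite /block_index; case: pselect => // h [<-]; exact: projT2 (cid h). Qed.

(** The infinite sum of the blocks, taken coordinatewise: at most one block contributes at each
    point, so no convergence enters. *)
Definition block_fun (u : l2 R X) (x : X) : R[i] :=
  oapp (fun n => theta n u x) 0 (block_index x).

Lemma theta_off n u x : x \notin F n -> theta n u x = 0.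
Proof. by move=> xF; rewrite rank1E l2Z zeta_supp// mulr0. Qed.

Lemma theta_mul m n : theta m * theta n = (m == n)%:R *: theta n.
Proof.
rewrite rank1_mul; have [->|mn] := eqVneq m n.
  by rewrite inner_self zeta1 expr1n scale1r.
rewrite (_ : inner _ _ = 0) ?scale0r// -(inner0l (0 : l2 R X)).
apply: inner_ext => x; rewrite l20 mul0r.
have [xm|xm] := boolP (x \in F m); last by rewrite (zeta_supp xm) rmorph0 mulr0.
rewrite (@zeta_supp n) ?mul0r//; apply: contra mn => xn.
by rewrite (Fdisj xm xn).
Qed.

Definition block_sum N : bop (l2 R X) := \sum_(n < N) theta n.

Lemma block_sumE N u x : block_sum N u x =
  if oapp (fun n => n < N)%N false (block_index x) then block_fun u x else 0.
Proof.
rewrite /block_sum bopE_sum l2_sum /block_fun.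
case h : (block_index x) => [n|]; rewrite [oapp _ _ _]/=.
  have xn := block_indexP h; case: ifPn => [nN|nN].
    rewrite (bigD1 (Ordinal nN))// big1 ?addr0 => [|i inn].
      exact: addr0.
    rewrite theta_off//; apply: contra inn => xi; apply/eqP/val_inj => /=.
    exact: Fdisj xi xn.
  rewrite big1// => i _; rewrite theta_off//; apply: contra nN => xi.
  by rewrite -(Fdisj xi xn).
rewrite big1// => i _; rewrite theta_off//; apply/negP => xi.
by rewrite (block_indexE xi) in h.
Qed.

Lemma block_sum_projection N : is_projection (block_sum N).
Proof.
split.
  rewrite /block_sum mulr_suml; apply: eq_bigr => i _.
  rewrite mulr_sumr (bigD1 i)// theta_mul eqxx scale1r.
  rewrite [X in _ + X = _]big1 => [|j ji].
    exact: addr0.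
  by rewrite theta_mul (_ : _ == _ = false) ?scale0r// eq_sym; apply/negbTE.
apply: adjoint_ofP => x z; rewrite !coef_sum rmorph_sum; apply: eq_bigr => i _.
exact: coef_adjoint_of (adjoint_rank1 _ _).
Qed.

Lemma block_bound (A : {fset X}) : exists N, forall x, x \in A ->
  forall n, block_index x = Some n -> (n < N)%N.
Proof.
exists (\max_(x <- A) oapp succn 0%N (block_index x)) => x xA n xn.
have : (oapp succn 0%N (block_index x) <=
   \max_(x <- A) oapp succn 0%N (block_index x))%N by exact: leq_bigmax_seq.
by rewrite xn.
Qed.

(** A finite set meets finitely many blocks, so on it [block_fun u] agrees with a finite block sum,
    which is a projection and hence contractive. *)
Lemma block_fun_sum u (A : {fset X}) :
  \sum_(x <- A) normc (block_fun u x) ^+ 2 <= l2norm u ^+ 2.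
Proof.
have [N hN] := block_bound A.
apply: (@le_trans _ _ (l2norm (block_sum N u) ^+ 2)); last first.
  rewrite lerXn2r ?nnegrE ?l2norm_ge0//.
  exact: projection_contractive (block_sum_projection N).
apply: le_trans (sum_le_l2norm _ A); rewrite le_eqVlt; apply/orP; left; apply/eqP.
apply: eq_big_seq => x xA; rewrite block_sumE.
case h : (block_index x) => [n|] /=; first by rewrite (hN x).
by rewrite /block_fun h.
Qed.

Fact block_l2 u : (block_fun u : X -> R[i]^o) \in @l2_pred R X.
Proof. by apply: l2_mem => A; exact: block_fun_sum. Qed.

Fact block_bop : (fun u => L2 (block_l2 u)) \in @bop_pred R (l2 R X).
Proof.
apply/bop_predP; split=> [c u v|].
  apply: l2_ext => x; rewrite l2D l2Z /= /block_fun.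
  case: (block_index x) => [n|]; last by rewrite /oapp mulr0 addr0.
  change (theta n (c *: u + v) x = c * theta n u x + theta n v x).
  by rewrite bopD bopZ.
exists 1 => u; rewrite mul1r !l2_normE lecR.
by apply: l2norm_le (l2norm_ge0 _) _ => A; exact: block_fun_sum.
Qed.

Definition block_op : bop (l2 R X) := Bop block_bop.

Lemma block_opE u x : block_op u x = block_fun u x. Proof. by []. Qed.

Lemma block_op_in n u x : x \in F n -> block_op u x = theta n u x.
Proof. by move=> xn; rewrite block_opE /block_fun (block_indexE xn). Qed.

Lemma block_op_out u x : (forall n, x \notin F n) -> block_op u x = 0.
Proof.
move=> xn; rewrite block_opE /block_fun; case h : (block_index x) => [n|//].
by have := xn n; rewrite (block_indexP h).
Qed.

Lemma coef_block_op n x z : x \in F n \/ z \in F n ->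
  coef block_op x z = zeta n x * conjc (zeta n z).
Proof.
move=> h; rewrite coefE.
have E m : theta m (delta R z) x = zeta m x * conjc (zeta m z).
  by rewrite -coefE coef_rank1.
have [xn|xn] := boolP (x \in F n); first by rewrite (block_op_in _ xn).
have zn : z \in F n by case: h => //; rewrite (negbTE xn).
rewrite (zeta_supp xn) mul0r.
have [[m xm]|nx] := pselect (exists m, x \in F m).
  rewrite (block_op_in _ xm) E (@zeta_supp m z) ?rmorph0 ?mulr0//.
  by apply: contra xn => zm; rewrite -(Fdisj zm zn).
by apply: block_op_out => m; apply/negP => xm; apply: nx; exists m.
Qed.

Lemma coef_block_op_out x z : (forall n, x \notin F n) -> coef block_op x z = 0.
Proof. by move=> h; rewrite coefE block_op_out. Qed.

Lemma block_op_projection : is_projection block_op.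
Proof.
split.
  apply: bop_ext => u; apply: l2_ext => x; rewrite bopE_M.
  have [[n xn]|nx] := pselect (exists n, x \in F n); last first.
    have h n : x \notin F n by apply/negP => xn; apply: nx; exists n.
    by rewrite !(block_op_out _ h).
  rewrite !(block_op_in _ xn) !rank1E !l2Z; congr (_ * _).
  have -> : inner (block_op u) (zeta n) = inner (inner u (zeta n) *: zeta n) (zeta n).
    apply: inner_ext => z; have [zn|zn] := boolP (z \in F n).
      by rewrite (block_op_in _ zn).
    by rewrite (zeta_supp zn) rmorph0 !mulr0.
  by rewrite innerZl inner_self zeta1 expr1n mulr1.
apply: adjoint_ofP => x z.
have [[n xzn]|nxz] := pselect (exists n, x \in F n \/ z \in F n).
  rewrite (coef_block_op xzn) (@coef_block_op n z x); last by case: xzn; [right|left].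
  by rewrite conjcM conjcK mulrC.
have hx n : x \notin F n by apply/negP => xn; apply: nxz; exists n; left.
have hz n : z \notin F n by apply/negP => zn; apply: nxz; exists n; right.
by rewrite !coef_block_op_out// rmorph0.
Qed.

Lemma block_corner n : chi R [set` F n] * block_op * chi R [set` F n] = theta n.
Proof.
apply: bop_ext => u; apply: l2_ext => x; rewrite !bopE_M.
change (restrict_fun [set` F n] (block_op (restrict_fun [set` F n] u)) x = theta n u x).
rewrite restrict_funE mem_setE; case: ifPn => xn; last by rewrite theta_off.
rewrite (block_op_in _ xn) !rank1E !l2Z; congr (_ * _).
apply: inner_ext => z; rewrite restrict_funE mem_setE; case: ifPn => // zn.
by rewrite (zeta_supp zn) rmorph0 !mulr0.
Qed.

(** Once [N] exceeds the index of every block meeting [A], the error vanishes on [A] and is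
    dominated elsewhere by the tail of [block_op v]. *)
Lemma block_op_cvg (v : l2 R X) :
  (fun N => block_sum N v) @ \oo --> block_op v.
Proof.
apply/cvgrPdist_le => -[er ei] e0.
have [/= /eqP ei0 er0] : ei = 0 /\ 0 < er.
  by move: e0; rewrite ltcE /= => /andP[/eqP -> ->].
have [A hA] := l2_dense (block_op v) er0; have [N hN] := block_bound A.
exists N => //= m Nm; rewrite l2_normE (eqP ei0) lecR.
apply: le_trans (ltW hA); apply: l2norm_mono => x.
rewrite restrict_setC l2B block_sumE restrict_funE in_setC mem_setE -block_opE.
have [xA|xA] := boolP (x \in A); last first.
  rewrite [if ~~ false then _ else _]/=; case: ifP => _; last by rewrite subr0.
  by rewrite subrr normc0 normc_ge0.
rewrite [if ~~ true then _ else _]/=.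
case h : (block_index x) => [n|]; rewrite [oapp _ _ _]/=.
  by rewrite (leq_trans (hN x xA n h) Nm) subrr.
by rewrite block_opE /block_fun h subr0.
Qed.

Lemma block_op_block_rank_one : block_rank_one block_op.
Proof.
exists (fun n => [set` F n]); split.
- apply/trivIsetP => m n _ _ mn; apply/seteqP; split=> // x [/= xm xn].
  by move/eqP: mn; apply; exact: Fdisj xm xn.
- move=> n; split; first exact: finite_fset.
  apply: contrapT => F0; have : zeta n = 0.
    apply: l2_ext => x; rewrite l20; apply: zeta_supp; apply/negP => xn.
    by apply: F0; exists x.
  move=> z0; have := zeta1 n; rewrite z0 l2norm0 => /eqP.
  by rewrite eq_sym oner_eq0.
- move=> v; under eq_fun do under eq_bigr do rewrite block_corner.
  rewrite (_ : (fun N => _) = fun N => block_sum N v); first exact: block_op_cvg.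
  by apply/funext => N; rewrite /block_sum bopE_sum.
- move=> n; rewrite block_corner; exists (zeta n).
    apply/eqP => z0; have := zeta1 n; rewrite z0 l2norm0 => /eqP.
    by rewrite eq_sym oner_eq0.
  apply/seteqP; split=> [_ [u _ <-]|_ [k _ <-]].
    by exists (inner u (zeta n)).
  by exists (k *: zeta n) => //; rewrite rank1E innerZl inner_self zeta1 expr1n mulr1.
Qed.

(** A nonzero entry is a product of two coordinates of one [zeta n]; outside the first [N] blocks
    one factor is at most [e] and the other at most 1. *)
Lemma block_op_ghost :
  (forall e : R, 0 < e -> exists N, forall n x, (N <= n)%N -> normc (zeta n x) <= e) ->
  ghost block_op.
Proof.
move=> vanish e e0; have [N hN] := vanish e e0.
exists (\bigcup_(n < N) [set` F n]).
  by apply: bigcup_finite => // n _; exact: finite_fset.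
move=> x z xA zA; rewrite normcE lecR.
have [[n xn]|nx] := pselect (exists n, x \in F n); last first.
  rewrite coef_block_op_out ?normc0 ?(ltW e0)// => n.
  by apply/negP => xn; apply: nx; exists n.
rewrite (@coef_block_op n); last by left.
have Nn : (N <= n)%N by rewrite leqNgt; apply/negP => nN; apply: xA; exists n.
rewrite normcM normcJ -[e]mulr1; apply: ler_pM; rewrite ?normc_ge0 ?hN//.
by apply: le_trans (normc_le_l2norm _ _) _; rewrite zeta1.
Qed.

End block_projections.

(** * From flat vectors to a block-rank-one ghost projection *)

Section ghost_obstruction.
Context (R : realType) (X Y : choiceType).
Context (EX : coarseStructure X) (EY : coarseStructure Y).
Context (Psi : bop (l2 R Y) -> bop (l2 R X)) (xi : Y -> l2 R X) (eta : X -> l2 R Y).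
Hypothesis cX : coarsely_connected EX.
Hypothesis Psi_mem : forall b, uRoe EY b -> uRoe EX (Psi b).
Hypothesis etaE : forall x y, eta x y = conjc (xi y x).
Hypothesis xi1 : forall y, l2norm (xi y) = 1.
Hypothesis eta1 : forall x, l2norm (eta x) = 1.
Hypothesis Psi_coef : forall b x x', uRoe EY b ->
  coef (Psi b) x x' = inner (b (eta x')) (eta x).

(** Consequently the norm of [Psi (chi R [set y]) (delta R x)] is the modulus of [xi y x]. *)
Lemma Psi_chi1 y : Psi (chi R [set y]) = rank1 (xi y) (xi y).
Proof.
apply: bop_coef_ext => x z; rewrite Psi_coef; last exact: chi_uRoe.
rewrite chi1_munit munitE innerZl inner_deltal coef_rank1 !etaE conjcK.
exact: mulrC.
Qed.

Lemma entourages_finite (F : {fset X}) :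
  entourages EX [set xz | xz.1 \in F /\ xz.2 \in F].
Proof.
have fin (L : seq (X * X)) : entourages EX [set xz | xz \in L].
  elim: L => [|[x z] L IH].
    by apply: entourages_sub (entourages_diag EX).
  apply: entourages_sub (entourages_union (cX x z) IH) => p.
  by rewrite /= inE => /orP[/eqP ->|]; [left|right].
apply: entourages_sub (fin [seq (x, z) | x <- F, z <- F]) => -[x z] [/= xF zF].
by apply/allpairsP; exists (x, z).
Qed.

Lemma sum_half_powers (N k : nat) :
  \sum_(i < k) (2%:R ^+ (N + i).+1)^-1 <= (2%:R ^+ N)^-1 :> R.
Proof.
have -> : \sum_(i < k) (2%:R ^+ (N + i).+1)^-1 = (2%:R ^+ N)^-1 - (2%:R ^+ (N + k))^-1 :> R.
  elim: k => [|k IH]; first by rewrite big_ord0 addn0 subrr.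
  rewrite big_ord_recr /= IH addnS exprS; field.
  by rewrite !expf_neq0.
by rewrite lerBlDr lerDl invr_ge0 exprn_ge0.
Qed.

Section perturbation.
Context (s : nat -> Y) (F : nat -> {fset X}) (zeta : nat -> l2 R X).
Hypothesis Fdisj : forall m n x, x \in F m -> x \in F n -> m = n.
Hypothesis zeta_supp : forall n x, x \notin F n -> zeta n x = 0.
Hypothesis zeta1 : forall n, l2norm (zeta n) = 1.
Hypothesis s_inj : injective s.
Hypothesis zeta_close : forall n,
  l2norm (zeta n - xi (s n)) <= (2 * 2 ^+ n.+1)^-1.

(* Up to finitely many blocks, the block projection is norm close to the image
   of the projection onto [l2 (range s)]. *)
Lemma uRoe_block_op : uRoe EX (block_op Fdisj zeta_supp zeta1).
Proof.
set q := block_op _ _ _.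
pose p := Psi (chi R (range s)).
have pX : uRoe EX p by apply: Psi_mem; exact: chi_uRoe.
pose t n := rank1 (zeta n) (zeta n) - rank1 (xi (s n)) (xi (s n)).
have tn n : opnorm (t n) <= (2 ^+ n.+1)^-1.
  apply: le_trans (rank1_dist _ _) _ => //.
  apply: le_trans (_ : 2 * (2 * 2 ^+ n.+1)^-1 <= _); first by rewrite ler_pM2l.
  by rewrite invfM mulrA mulfV// mul1r.
have tX n : uRoe EX (t n).
  apply: uRoeB; last by rewrite -Psi_chi1; apply: Psi_mem; exact: chi_uRoe.
  apply: uRoe_fin; apply: entourages_sub (entourages_finite (F n)) => -[x z] /suppP.
  rewrite coef_rank1 => h; split=> /=; apply: contra_neqT h => hF.
    by rewrite (zeta_supp hF) mul0r.
  by rewrite (zeta_supp hF) rmorph0 mulr0.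
apply: uRoe_closed => e e0.
(* The corrections [t n] with [n >= N] have norms adding up to at most [2 ^- N]. *)
have [N Ne] : exists N, (2 ^+ N)^-1 <= e :> R.
  exists (Num.truncn e^-1).+1.
  have h : e^-1 < (Num.truncn e^-1).+1%:R by exact: truncnS_gt.
  rewrite -[X in _ <= X]invrK lef_pV2 ?posrE ?exprn_gt0 ?invr_gt0//.
  apply: le_trans (ltW h) _; rewrite -natrX ler_nat; apply: ltnW; exact: ltn_expl.
exists (p + \sum_(n < N) t n); first by apply: uRoeD => //; exact: uRoe_sum.
(* The remainder is compared with finite sums of later corrections only entry by entry on [A]; the
   uniform norm bound then passes to it. *)
apply: le_trans Ne; apply: opnorm_le_coefs => [|d A d0].
  by rewrite invr_ge0 exprn_ge0.
have [C hC] : exists C : {fset Y}, forall z, z \in A ->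
    l2norm (restrict_fun (~` [set` C]) (eta z)) <= d.
  have /choice[C hC] z : exists C : {fset Y},
      l2norm (eta z - restrict_fun [set` C] (eta z)) < d.
    exact: l2_dense.
  exists (\bigcup_(z <- A) C z)%fset => z zA; apply: le_trans (ltW (hC z)).
  rewrite restrict_setC; apply: l2norm_mono => y.
  rewrite !restrict_funE !in_setC !mem_setE.
  have [yC|yC] := boolP (y \in C z).
    suff -> : y \in (\bigcup_(z0 <- A) C z0)%fset by [].
    by apply/bigfcupP; exists z => //; rewrite zA.
  by case: ifP => // _; rewrite normc0 normc_ge0.
have [N1 hN1] := block_bound F A.
have [N2 hN2] : exists N2, forall n, s n \in C -> (n < N2)%N.
  pose f y := if pselect (exists n, s n = y) is left h then (projT1 (cid h)).+1 else 0%N.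
  exists (\max_(y <- C) f y) => n sC.
  have : (f (s n) <= \max_(y <- C) f y)%N by exact: leq_bigmax_seq.
  rewrite /f; case: pselect => [h|[]]; last by exists n.
  by rewrite (s_inj (projT2 (cid h))).
(* All blocks meeting [A] have index below [N1], and all [n] with [s n] in [C] are below [N2]. So
   the block part is exact on [A], and the missing part of [range s] lies off [C], where each
   [eta z] has norm at most [d]. *)
pose k := (N1 + N2)%N.
exists (\sum_(i < k) t (N + i)%N).
  apply: le_trans (opnorm_sum _ _ _) _; apply: le_trans (sum_half_powers N k).
  by apply: ler_sum => i _; exact: tn.
move=> x z xA zA.
have sumE : \sum_(n < N) t n + \sum_(i < k) t (N + i)%N = \sum_(n < N + k) t n.
  by rewrite [RHS]big_split_ord /=.
rewrite -coefB.
have -> : q - (p + \sum_(n < N) t n) - \sum_(i < k) t (N + i)%N =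
    q - p - \sum_(n < N + k) t n by rewrite -sumE !opprD !addrA.
have -> : \sum_(n < N + k) t n = block_sum zeta (N + k) -
    \sum_(n < N + k) rank1 (xi (s n)) (xi (s n)) by rewrite sumrB.
rewrite !coefB.
have -> : coef q x z = coef (block_sum zeta (N + k)) x z.
  rewrite !coefE (block_sumE Fdisj zeta_supp) /q block_opE.
  case h : (block_index F x) => [n|]; last by rewrite /block_fun h.
  have nN := hN1 _ xA _ h; rewrite [oapp _ _ _]/=.
  by rewrite (leq_trans nN)// /k addnCA leq_addr.
set a := coef (block_sum _ _) _ _.
rewrite (_ : _ - _ =
  \sum_(n < N + k) coef (rank1 (xi (s n)) (xi (s n))) x z - coef p x z); last first.
  by rewrite coef_sum; ring.
rewrite normc_distC Psi_coef; last exact: chi_uRoe.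
pose T := [fset s (val n) | n in 'I_(N + k)]%fset.
have -> : \sum_(n < N + k) coef (rank1 (xi (s n)) (xi (s n))) x z =
    inner (restrict_fun [set` T] (eta z)) (eta x).
  rewrite restrict_fset_sum inner_suml big_imfset /=; last first.
    by move=> m n _ _ /s_inj/val_inj.
  rewrite big_enum; apply: eq_bigr => n _.
  by rewrite innerZl inner_deltal coef_rank1 !etaE conjcK mulrC.
rewrite -innerBl; apply: le_trans (cauchy_schwarz _ _) _; rewrite eta1 mulr1.
apply: le_trans (hC z zA); apply: l2norm_mono => y.
rewrite l2B; change (chi R (range s) (eta z) y) with (restrict_fun (range s) (eta z) y).
rewrite !restrict_funE in_setC !mem_setE.
have [[n ny]|ns] := pselect (exists n, s n = y).
  have -> : y \in range s by apply: mem_set; exists n.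
  case: (boolP (y \in T)) => yT; first by rewrite subrr normc0 normc_ge0.
  rewrite subr0; case: (boolP (y \in C)) => // yC.
  exfalso; move/negP: yT; apply; have nk : (n < N + k)%N.
    by rewrite -ny in yC; rewrite (leq_trans (hN2 _ yC))// /k addnA leq_addl.
  by apply/imfsetP; exists (Ordinal nk).
rewrite memNset; last by move=> [n _ ny]; apply: ns; exists n.
case: ifP => [/imfsetP[n _ /= yn]|_]; first by case: ns; exists n.
by rewrite subrr normc0 normc_ge0.
Qed.

End perturbation.

Lemma ghost_obstruction :
  (~ exists p : bop (l2 R X),
     [/\ uRoe EX p, is_projection p, block_rank_one p & ghost p]) ->
  exists2 d : R, 0 < d & forall y, exists x, d < normc (xi y x).
Proof.
move=> noghost; apply: contrapT => nlarge; apply: noghost.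
have small (d : R) : 0 < d -> exists y, forall x, normc (xi y x) <= d.
  move=> d0; apply: contrapT => h; apply: nlarge; exists d => // y.
  apply: contrapT => /forallNP hy; apply: h; exists y => x.
  by rewrite leNgt; apply/negP/hy.
(* Twice [tau n] is the tolerance required in [zeta_close]: one [tau n] for truncating and one for
   normalizing. The factor 8 keeps [r n] above [2^-1]. *)
pose tau n : R := (8 * 2 ^+ n)^-1.
have tau0 n : 0 < tau n by rewrite invr_gt0 mulr_gt0// exprn_gt0.
have tau8 n : tau n <= 8^-1.
  by rewrite /tau invfM ler_piMr// invf_le1 ?exprn_gt0// exprn_ege1// ler1n.
have [s [F [Fsmall Fclose Fdisj]]] := gliding_hump tau0 small.
pose u n := restrict_fun [set` F n] (xi (s n)).
pose r n := l2norm (u n).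
have r_lb n : 1 - tau n <= r n.
  rewrite lerBlDl -(xi1 (s n)) -{1}(subrK (u n) (xi (s n))).
  by apply: le_trans (l2normD _ _) _; rewrite lerD2r.
have r_ub n : r n <= 1 by rewrite -(xi1 (s n)) l2norm_restrict_le.
have r_half n : 2^-1 <= r n by have := r_lb n; have := tau8 n; lra.
have r0 n : 0 < r n by apply: lt_le_trans (r_half n); rewrite invr_gt0.
pose zeta n := ((r n)^-1)%:C%C *: u n.
have nr n : normc ((r n)^-1)%:C%C = (r n)^-1 by rewrite normc_real// invr_ge0 ltW.
have zeta1 n : l2norm (zeta n) = 1.
  by rewrite l2normZ nr mulVf// gt_eqF.
have zeta_supp n x : x \notin F n -> zeta n x = 0.
  by move=> xF; rewrite l2Z restrict_funE mem_setE (negbTE xF) mulr0.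
have zeta_close n : l2norm (zeta n - xi (s n)) <= (2 * 2 ^+ n.+1)^-1.
  have -> : (2 * 2 ^+ n.+1)^-1 = tau n + tau n :> R.
    by rewrite /tau exprS; field; rewrite expf_neq0.
  have -> : zeta n - xi (s n) = ((r n)^-1 - 1)%:C%C *: u n + (u n - xi (s n)).
    by rewrite rmorphB scalerBl scale1r addrA subrK.
  apply: le_trans (l2normD _ _) _; apply: lerD; last by rewrite l2normB_sym.
  rewrite l2normZ normc_real ?subr_ge0 ?invf_ge1//.
  rewrite -/(r n) mulrBl mul1r mulVf ?gt_eqF//.
  by have := r_lb n; lra.
(* A repeated vector would carry norm at least [2^-1] on [F n], which is disjoint from [F m],
   against a tail of norm at most [8^-1] off [F m]. *)
have s_inj : injective s.
  move=> m n smn; apply: contrapT => mn.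
  have : r n <= tau m.
    apply: le_trans (Fclose m); apply: l2norm_mono => x.
    rewrite restrict_setC !restrict_funE in_setC !mem_setE -smn.
    case: (boolP (x \in F n)) => xn; last by rewrite normc0 normc_ge0.
    suff /negbTE -> : x \notin F m by [].
    by apply/negP => xm; apply: mn; exact: Fdisj xm xn.
  by have := r_half n; have := tau8 m; lra.
exists (block_op Fdisj zeta_supp zeta1); split.
- exact: (uRoe_block_op s_inj zeta_close).
- exact: block_op_projection.
- exact: block_op_block_rank_one.
- apply: block_op_ghost => e e0.
  exists (Num.truncn e^-1).+1 => n x Nn.
  apply: (@le_trans _ _ (2 * tau n)).
    rewrite l2Z normcM nr; apply: ler_pM; rewrite ?invr_ge0 ?normc_ge0 ?(ltW (r0 n))//.
      by rewrite -[2]invrK lef_pV2 ?posrE ?invr_gt0.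
    rewrite restrict_funE; case: ifP => _; first exact: Fsmall.
    by rewrite normc0 ltW.
  rewrite -[X in _ <= X]invrK /tau.
  have h : e^-1 < (Num.truncn e^-1).+1%:R by exact: truncnS_gt.
  have -> : 2 * (8 * 2 ^+ n)^-1 = (4 * 2 ^+ n)^-1 :> R.
    by field; rewrite expf_neq0.
  rewrite lef_pV2 ?posrE ?mulr_gt0 ?exprn_gt0 ?invr_gt0//.
  apply: le_trans (ltW h) _; apply: (@le_trans _ _ (2 ^+ n)); last first.
    by rewrite ler_peMl ?exprn_ge0// ler1n.
  rewrite -natrX ler_nat; apply: leq_trans Nn (ltnW _); exact: ltn_expl.
Qed.

End ghost_obstruction.

(** * Coarse equivalences *)

Section coarse_spaces.
Context (R : realType) (X Y : choiceType).
Context (EX : coarseStructure X) (EY : coarseStructure Y).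

Lemma metrizable_connected : metrizable R EX -> coarsely_connected EX.
Proof.
move=> [d dM dE] x z; apply/dE; exists (d x z) => _ [p /= -> <-].
exact: lexx.
Qed.

Lemma metrizable_cofinal : metrizable R EX -> exists E : nat -> set (X * X),
  (forall n, entourages EX (E n)) /\
  (forall F, entourages EX F -> exists n, F `<=` E n).
Proof.
move=> [d dM dE]; exists (fun n => [set p | d p.1 p.2 <= n%:R]); split=> [n|F].
  by apply/dE; exists n%:R => _ [p /= hp <-].
move=> /dE[M hM]; exists (Num.truncn `|M|).+1 => p Fp /=.
apply: le_trans (_ : M <= _); first by apply: hM; exists p.
by apply: le_trans (ler_norm M) _; apply: ltW; exact: truncnS_gt.
Qed.

Lemma metrizable_coarse_embedding (g : Y -> X) :
  coarse_embedding EY EX g -> metrizable R EX -> metrizable R EY.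
Proof.
move=> [gc ge] [d [d_ge0 d_eq0 d_sym d_tri] dE].
(* The pulled-back metric is raised by 1 off the diagonal, as [g] may identify points; boundedness
   is unaffected. *)
pose d' y z : R := if y == z then 0 else d (g y) (g z) + 1.
have d'0 y z : 0 <= d' y z by rewrite /d'; case: ifP => // _; rewrite addr_ge0.
exists d'; first split=> [//|y z|y z|y z w].
- rewrite /d'; case: eqP => [//|yz]; split=> [h|//].
  by have := d_ge0 (g y) (g z); rewrite -[X in _ <= X](addrK 1) h sub0r ler0N1.
- by rewrite /d' eq_sym d_sym.
- rewrite {1}/d'; case: (eqVneq y w) => [_|yw]; first by rewrite addr_ge0.
  rewrite /d'; have [yz|yz] := eqVneq y z.
    by rewrite add0r -yz (negbTE yw).
  have [<-|zw] := eqVneq z w; first by rewrite addr0.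
  by have := d_tri (g y) (g z) (g w); lra.
move=> F; split=> [/gc[E /dE[M hM] hF]|[M hM]].
  exists (`|M| + 1) => _ [[y z] Fyz <-] /=; rewrite /d'; case: eqP => _.
    by rewrite addr_ge0.
  rewrite lerD2r; apply: le_trans (ler_norm M); apply: hM.
  by exists (g y, g z) => //; exact: hF.
have [|E EE hE] := ge [set p | d p.1 p.2 <= `|M|].
  by apply/dE; exists `|M| => _ [p /= hp <-].
apply: entourages_sub EE => -[y z] Fyz; apply: contrapT => /hE; apply => /=.
have [<-|yz] := eqVneq y z; first by rewrite (d_eq0 _ _).2.
apply: le_trans (ler_norm M); have : d' y z <= M by apply: hM; exists (y, z).
by rewrite /d' (negbTE yz); apply: le_trans; rewrite lerDl.
Qed.

(** Transport from [Y] to [X] makes [g] coarse, and transport from [X] to [Y] makes it expanding.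
    The transported diagonal of [Y] contains every pair [(g (f x), x)], witnessed by [f x], so the
    image of [g] is coarsely dense. *)
Lemma coarse_equivalence_of_kernel (Phi : bop (l2 R X) -> bop (l2 R Y))
    (Psi : bop (l2 R Y) -> bop (l2 R X)) xi eta (f : X -> Y) (g : Y -> X) (d : R) :
  uniformly_locally_finite EX -> uniformly_locally_finite EY ->
  star_isomorphism EX EY Phi -> star_isomorphism EY EX Psi ->
  spatial_kernel EX EY Phi Psi xi eta -> 0 < d ->
  (forall x, d <= normc (xi (f x) x)) -> (forall y, d <= normc (xi y (g y))) ->
  coarse_equivalence EY EX g.
Proof.
move=> ulfX ulfY isoPhi isoPsi [etaE [xi1 eta1] Phic Psic] d0 hf hg.
have n x y : normc (eta x y) = normc (xi y x) by rewrite etaE normcJ.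
have toX F (FE : entourages EY F) :=
  transport ulfY (iso_mem isoPsi) etaE xi1 eta1 Psic FE d0.
have xiE y x : xi y x = conjc (eta x y) by rewrite etaE conjcK.
have toY E (EE : entourages EX E) :=
  transport ulfX (iso_mem isoPhi) xiE eta1 xi1 Phic EE d0.
split; first split.
- move=> F /toX FE; apply: (ex_intro2 _ _ _ FE).
  by move=> y z Fyz; exists (y, z); rewrite /= !n.
- move=> E /toY EE; apply: (ex_intro2 _ _ _ EE).
  by move=> y z h Ehyz; apply: h; exists (g y, g z).
- apply: (ex_intro2 _ _ _ (toX _ (entourages_diag EY))).
  by move=> x; exists (f x); exists (f x, f x); rewrite /= !n.
Qed.

End coarse_spaces.

Theorem theorem1p5 (R : realType) (X Y : choiceType)
    (EX : coarseStructure X) (EY : coarseStructure Y)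
    (Phi : bop (l2 R X) -> bop (l2 R Y)) :
  uniformly_locally_finite EX ->
  uniformly_locally_finite EY ->
  star_isomorphism EX EY Phi ->
  metrizable R EX ->
  (~ exists p : bop (l2 R X),
     [/\ uRoe EX p, is_projection p, block_rank_one p & ghost p]) ->
  let large_at (g : Y -> X) := exists2 dlt : R, 0 < dlt &
    forall y : Y,
      dlt%:C%C < `|iso_inv EX Phi (chi R [set y]) (delta R (g y))| in
  [/\ coarsely_equivalent EX EY,
      metrizable R EY,
      exists g : Y -> X, large_at g &
      forall g : Y -> X, large_at g -> coarse_equivalence EY EX g].
Proof.
move=> ulfX ulfY isoPhi mX noghost large_at.
have cX := metrizable_connected mX.
have isoPsi := star_isomorphism_inv isoPhi.
set Psi := iso_inv EX Phi in isoPsi *.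
have PhiK a : uRoe EX a -> Psi (Phi a) = a by exact: (iso_invK isoPhi).
have PsiK b : uRoe EY b -> Phi (Psi b) = b by exact: (iso_invKV isoPhi).
have [xi [eta ker]] := spatial_kernel_exists isoPhi isoPsi PhiK PsiK cX.
have [etaE [xi1 eta1] Phic Psic] := ker.
have largeE (dl : R) y x : (dl%:C%C < `|Psi (chi R [set y]) (delta R x)|) =
    (dl < normc (xi y x)).
  rewrite (Psi_chi1 etaE Psic) rank1E inner_deltal l2_normE l2normZ xi1 mulr1.
  by rewrite normcJ ltcR.
have [E [EE Ecof]] := metrizable_cofinal mX.
have [d1 d10 /choice[f hf]] := large_coordinates ulfX isoPsi eta1 Psic EE Ecof.
have {}hf x : d1 < normc (xi (f x) x) by have := hf x; rewrite etaE normcJ.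
have [d2 d20 /choice[g0 hg0]] := ghost_obstruction cX
  (iso_mem isoPsi) etaE xi1 eta1 Psic noghost.
have equiv g : large_at g -> coarse_equivalence EY EX g.
  move=> [d3 d30 hg]; pose d := Num.min d1 d3.
  have d0 : 0 < d by rewrite lt_min d10.
  apply: (coarse_equivalence_of_kernel ulfX ulfY isoPhi isoPsi ker d0 (f := f)) => [x|y].
    by apply/ltW/(le_lt_trans _ (hf x)); rewrite ge_min lexx.
  have := hg y; rewrite largeE => /ltW; apply: le_trans.
  by rewrite ge_min lexx orbT.
have g0_large : large_at g0 by exists d2 => // y; rewrite largeE.
(* The kernel is symmetric in the two spaces, so the same lemma makes [f] a coarse equivalence from
   [X] to [Y]. *)
have ker' : spatial_kernel EY EX Psi Phi eta xi.
  by split=> // y x; rewrite etaE conjcK.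
split=> //; last by exists g0.
- exists f; pose d := Num.min d1 d2.
  have d0 : 0 < d by rewrite lt_min d10.
  apply: (coarse_equivalence_of_kernel ulfY ulfX isoPsi isoPhi ker' d0 (f := g0)) => [y|x].
    rewrite etaE normcJ; apply/ltW/(le_lt_trans _ (hg0 y)).
    by rewrite ge_min lexx orbT.
  by rewrite etaE normcJ; apply/ltW/(le_lt_trans _ (hf x)); rewrite ge_min lexx.
- exact: metrizable_coarse_embedding (equiv _ g0_large).1 mX.
Qed.
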